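(* Let $\delta^X$ be the arithmetic $\delta^A$-flow on $\widehat{X}$ fixed in the context (with properties (1) and (2) there), and let $\phi^X$ be the attached Frobenius lift. Let $c_2\in A^{\times}$ be such that $\delta^A c_2=0$, let $\phi_{c_2}$ be the Frobenius lift on $\widehat{S^0_{c_2}}$ induced by $\phi^X$, and set $$\lambda:=\frac{H_1^{p-1}}{A_{p-1}(H_1,c_2)}\in \mathcal{O}(\widehat{S^0_{c_2}}).$$ Then the following holds in $\Omega^2_{\widehat{S^0_{c_2}}}$: $$\frac{\phi_{c_2}^*}{p^2}\,\eta_{c_2}\equiv \lambda\, \eta_{c_2} \pmod p .$$
   Context: **Base ring, Frobenius lifts, $p$-derivations.** Let $p$ be an odd prime and $A$ a complete discrete valuation ring with maximal ideal generated by $p$ and perfect residue field $k=A/pA$. Let $\phi^A:A\to A$ be its unique Frobenius lift, i.e. the unique ring endomorphism whose reduction mod $p$ is the $p$-power Frobenius, and put $\delta^A(a)=(\phi^A(a)-a^p)/p$. A hat denotes $p$-adic completion of schemes over $A$. A Frobenius lift on a $p$-adic formal scheme $Y$ over $A$ is an endomorphism of $Y$, compatible with $\phi^A$, whose reduction mod $p$ is the $p$-power Frobenius. An arithmetic $\delta^A$-flow on $Y$ ($p$-torsion free) is a map of sheaves of sets $\delta^Y:\mathcal{O}_Y\to\mathcal{O}_Y$ such that $b\mapsto b^p+p\,\delta^Y b$ is a map of sheaves of rings (compatible with $\phi^A$ on $A$), hence defines a Frobenius lift $\phi^Y$ on $Y$, said to be attached to $\delta^Y$. **Forms.** For a smooth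 scheme $Y$ over $A$, $\Omega_{\widehat Y}=\varprojlim_n \Omega_{Y_n/A_n}$ with $A_n=A/p^nA$, $Y_n=Y\otimes A_n$, and $\Omega^i_{\widehat Y}=\wedge^i\Omega_{\widehat Y}$. For a Frobenius lift $\phi$ on $\widehat Y$ the pull-back $\phi^*$ on $\Omega^i_{\widehat Y}$ is divisible by $p^i$, giving additive maps $\frac{\phi^*}{p^i}:\Omega^i_{\widehat Y}\to\Omega^i_{\widehat Y}$. **Euler setting.** Let $a_1,a_2,a_3\in A$ with $(a_1-a_2)(a_2-a_3)(a_3-a_1)\in A^\times$. Put $H_1=\sum_{i=1}^3 a_ix_i^2$ and $H_2=\sum_{i=1}^3 x_i^2$ in $A[x_1,x_2,x_3]$, and $$N(z_1,z_2)=\prod_{i=1}^3(z_1-a_iz_2)\in A[z_1,z_2].$$ Let $$F=((a_2-a_3)x^2+z_1-a_2z_2)((a_3-a_1)x^2-z_1+a_1z_2)\in A[z_1,z_2][x],$$ and let $A_{p-1}\in A[z_1,z_2]$ (the Hasse invariant) be the coefficient of $x^{p-1}$ in $F^{\frac{p-1}{2}}$. Put $$Q=x_1x_2\cdot N(H_1,H_2)\cdot A_{p-1}(H_1,H_2),\qquad X=\operatorname{Spec} A[x_1,x_2,x_3][1/Q]\subset\mathbb{A}^3.$$ **The curves $E_c$.** For $c=(c_1,c_2)\in A^2$ let $E_c=\operatorname{Spec} A[x_1,x_2,x_3]/(H_1-c_1,H_2-c_2)$ and $E_c^0=E_c\cap X$. If $N(c_1,c_2)\in A^\times$, then $E_c$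 is smooth over $A$ and carries the global $1$-form $\omega_c$ obtained by gluing the restrictions to $E_c$ of $$\frac{dx_1}{(a_2-a_3)x_2x_3},\quad \frac{dx_2}{(a_3-a_1)x_3x_1},\quad \frac{dx_3}{(a_1-a_2)x_1x_2};$$ its restriction to $E_c^0$ is still denoted $\omega_c$. **The flow $\delta^X$.** By a known theorem, there exists an arithmetic $\delta^A$-flow $\delta^X$ on $\widehat{X}$ with the following two properties; fix such a $\delta^X$, with attached Frobenius lift $\phi^X$. (1) $\delta^X H_1=\delta^X H_2=0$ in $\mathcal{O}(\widehat{X})$. (2) For every $c=(c_1,c_2)\in A^2$ with $\delta^A c_1=\delta^A c_2=0$ and $N(c_1,c_2)\cdot A_{p-1}(c_1,c_2)\in A^{\times}$, the Frobenius lift $\phi_c$ on $\widehat{E^0_c}$ induced by $\phi^X$ satisfies, in $\Omega^1_{\widehat{E^0_c}}$, $$\frac{\phi_c^*}{p}\omega_c\equiv A_{p-1}(c_1,c_2)^{-1}\cdot \omega_c \pmod p .$$ **The spheres $S_{c_2}$.** For $c_2\in A^\times$ let $S_{c_2}=\operatorname{Spec} A[x_1,x_2,x_3]/(H_2-c_2)$ and $S^0_{c_2}=S_{c_2}\cap X$. The $2$-forms $$\frac{dx_2\wedge dx_3}{x_1},\quad \frac{dx_3\wedge dx_1}{x_2},\quad \frac{dx_1\wedge dx_2}{x_3},$$ defined on the loci in $S_{c_2}$ where $x_1$, $x_2$, $x_3$ respectively are invertible, glue to a symplectic (i.e. invertible) $2$-form $\eta_{c_2}$ on $S_{c_2}$.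 If $\delta^A c_2=0$, then, since $\delta^XH_2=0$, $\phi^X$ induces a Frobenius lift $\phi_{c_2}$ on $\widehat{S^0_{c_2}}$. The function $A_{p-1}(H_1,c_2)$ is invertible on $\widehat{S^0_{c_2}}$.
   Formalization: The residue field k is assumed infinite: for finite k the congruence can fail for a flow satisfying (1) and (2), e.g. A=Z_3, (a_1,a_2,a_3)=(0,1,2), c_2=1, where (2) is vacuous. *)

(* Defs.v *)
From HB Require Import structures.
From mathcomp Require Import all_boot all_order all_algebra.
From mathcomp.multinomials Require Export mpoly.

Set Implicit Arguments.
Unset Strict Implicit.
Unset Printing Implicit Defensive.

Import GRing.Theory.
Local Open Scope ring_scope.

(* Rings attached to affine schemes are [comPzRingType]s, so that the zero ring
   (the empty scheme) is allowed: Y_0 is always empty, and so is the formal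
   completion of a scheme with empty special fibre. *)

(* Congruence modulo m, in a ring or in a module. *)
Definition cong (V : zmodType) (m : nat) (u v : V) : Prop :=
  exists w : V, u - v = w *+ m.

Section BaseRing.
Variables (p : nat) (A : idomainType).

Definition dvr_with_uniformizer : Prop :=
  [/\ (p%:R : A) != 0, (p%:R : A) \isn't a GRing.unit &
      forall a : A, a != 0 ->
        exists n (u : A), u \is a GRing.unit /\ a = u * p%:R ^+ n].

(* Separatedness of the topology is automatic in a discrete valuation ring. *)
Definition padically_complete : Prop :=
  forall s : nat -> A, (forall n, cong (p ^ n) (s n.+1) (s n)) ->
    exists l : A, forall n, cong (p ^ n) l (s n).

(* Surjectivity of the Frobenius of A/pA. *)
Definition perfect_residue_field : Prop :=
  forall a : A, exists b : A, cong p a (b ^+ p).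

Definition infinite_residue_field : Prop :=
  forall s : seq A, exists a : A, forall b, b \in s -> ~ cong p a b.

End BaseRing.

(* phi is the map b |-> b^p + p * delta b; as [phi] is required to be a ring
   endomorphism wherever this is used, it is a lift of Frobenius. *)
Definition attached (p : nat) (R : comPzRingType) (delta : R -> R)
    (phi : {rmorphism R -> R}) : Prop :=
  forall b, phi b = b ^+ p + delta b *+ p.

Section Algebra.

Definition quotient_by_nat (R S : comPzRingType) (m : nat)
    (f : {rmorphism R -> S}) : Prop :=
  (forall y, exists x, f x = y) /\ (forall x, f x = 0 <-> cong m x 0).

Definition in_ideal (R : comPzRingType) (gs : seq R) (r : R) : Prop :=
  exists h : 'I_(size gs) -> R, r = \sum_i h i * gs`_i.

(* f presents S as (R / (gs)) [1/q]. *)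
Definition localized_quotient (R S : comPzRingType) (gs : seq R) (q : R)
    (f : {rmorphism R -> S}) : Prop :=
  [/\ exists v, f q * v = 1,
      forall s, exists r n, s * f q ^+ n = f r &
      forall r, f r = 0 <-> exists n, in_ideal gs (q ^+ n * r)].

Definition inverse_limit (T : nat -> Type) (t : forall n, T n.+1 -> T n)
    (L : Type) (q : forall n, L -> T n) : Prop :=
  (forall n x, t n (q n.+1 x) = q n x) /\
  (forall s : (forall n, T n), (forall n, t n (s n.+1) = s n) ->
     exists! x, forall n, q n x = s n).

Definition semilinear (R S : comPzRingType) (f : R -> S)
    (M : lmodType R) (N : lmodType S) (g : M -> N) : Prop :=
  {morph g : u v / u + v} /\ forall a u, g (a *: u) = f a *: g u.

Definition derivation (k R : comPzRingType) (alg : k -> R) (M : lmodType R)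
    (d : R -> M) : Prop :=
  [/\ {morph d : x y / x + y},
      forall x y, d (x * y) = x *: d y + y *: d x &
      forall a, d (alg a) = 0].

Definition kaehler_differentials (k R : comPzRingType) (alg : k -> R)
    (Omega : lmodType R) (d : R -> Omega) : Prop :=
  derivation alg d /\
  forall (M : lmodType R) (D : R -> M), derivation alg D ->
    exists u : {linear Omega -> M}, (forall x, u (d x) = D x) /\
      forall v : {linear Omega -> M}, (forall x, v (d x) = D x) -> v =1 u.

Definition alternating_bilinear (R : comPzRingType) (M N : lmodType R)
    (b : M -> M -> N) : Prop :=
  [/\ forall a u u' v, b (a *: u + u') v = a *: b u v + b u' v,
      forall a u v v', b u (a *: v + v') = a *: b u v + b u v' &
      forall u, b u u = 0].

Definition exterior_square (R : comPzRingType) (M W : lmodType R)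
    (wedge : M -> M -> W) : Prop :=
  alternating_bilinear wedge /\
  forall (N : lmodType R) (b : M -> M -> N), alternating_bilinear b ->
    exists u : {linear W -> N}, (forall x y, u (wedge x y) = b x y) /\
      forall v : {linear W -> N}, (forall x y, v (wedge x y) = b x y) -> v =1 u.

End Algebra.

Section Formal.
Variables (p : nat) (A : idomainType).
Local Notation poly3 := {mpoly A[3]}.

(* The p-adic completion of Y = Spec (A[x1,x2,x3] / (gs)) [1/q]; [fun_ring] is
   its ring of global functions and [red n] is the coordinate ring of
   Y_n = Y (x) A/p^n. As Y is affine, all sheaves on the completion of Y are
   given by their global sections. *)
Record formal_completion (gs : seq poly3) (q : poly3) := FormalCompletion {
  coord : comPzRingType;
  coord_map : {rmorphism poly3 -> coord};
  coordP : localized_quotient gs q coord_map;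
  red : nat -> comPzRingType;
  red_map : forall n, {rmorphism coord -> red n};
  redP : forall n, quotient_by_nat (p ^ n) (red_map n);
  trans : forall n, {rmorphism red n.+1 -> red n};
  transP : forall n b, trans n (red_map n.+1 b) = red_map n b;
  fun_ring : comPzRingType;
  proj : forall n, {rmorphism fun_ring -> red n};
  projP : inverse_limit (fun n => trans n : red n.+1 -> red n)
                        (fun n => proj n : fun_ring -> red n);
  completion_map : {rmorphism coord -> fun_ring};
  completion_mapP : forall n b, proj n (completion_map b) = red_map n b
}.

(* The function on the completion defined by a polynomial. *)
Definition fn gs q (Y : formal_completion gs q) (f : poly3) : fun_ring Y :=
  completion_map Y (coord_map Y f).

Definition cst gs q (Y : formal_completion gs q) (a : A) : fun_ring Y :=
  fn Y a%:MP.

Definition red_cst gs q (Y : formal_completion gs q) n (a : A) : red Y n :=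
  red_map Y n (coord_map Y a%:MP).

(* Differential forms on the completion of Y: [Omega1] is the limit of the
   modules of Kaehler differentials of Y_n over A/p^n (the same as over A, since
   A -> A/p^n is onto), and [Omega2] is its exterior square. *)
Record forms gs q (Y : formal_completion gs q) := Forms {
  Omega_red : forall n, lmodType (red Y n);
  d_red : forall n, red Y n -> Omega_red n;
  d_redP : forall n, kaehler_differentials (red_cst Y n) (d_red (n := n));
  Omega_trans : forall n, Omega_red n.+1 -> Omega_red n;
  Omega_trans_semilinear :
    forall n, semilinear (trans Y n) (Omega_trans (n := n));
  Omega_trans_d :
    forall n b, Omega_trans (d_red b) = d_red (trans Y n b);
  Omega1 : lmodType (fun_ring Y);
  Omega_proj : forall n, Omega1 -> Omega_red n;
  Omega_proj_semilinear : forall n, semilinear (proj Y n) (Omega_proj n);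
  Omega_projP : inverse_limit Omega_trans Omega_proj;
  diff : fun_ring Y -> Omega1;
  diffP : forall n b, Omega_proj n (diff b) = d_red (proj Y n b);
  Omega2 : lmodType (fun_ring Y);
  wedge : Omega1 -> Omega1 -> Omega2;
  wedgeP : exterior_square wedge
}.

(* The restriction to the completion of a subscheme. *)
Definition restriction gs q (Y : formal_completion gs q) gs' q'
    (Z : formal_completion gs' q') (r : {rmorphism fun_ring Y -> fun_ring Z}) :
    Prop :=
  forall f, r (fn Y f) = fn Z f.

Definition induces (R S : comPzRingType) (r : {rmorphism R -> S})
    (phi : {rmorphism R -> R}) (psi : {rmorphism S -> S}) : Prop :=
  forall b, psi (r b) = r (phi b).

Section Pullback.
Variables (gs : seq poly3) (q : poly3) (Y : formal_completion gs q).
Variables (O : forms Y) (phi : {rmorphism fun_ring Y -> fun_ring Y}).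

Definition pullback1 (F : Omega1 O -> Omega1 O) : Prop :=
  semilinear phi F /\ forall b, F (diff O b) = diff O (phi b).

Definition pullback2 (F : Omega1 O -> Omega1 O) (F2 : Omega2 O -> Omega2 O) :
    Prop :=
  [/\ pullback1 F, semilinear phi F2 &
      forall u v, F2 (wedge u v) = wedge (F u) (F v)].

(* G = phi^* / p on 1-forms. *)
Definition divided_pullback1 (G : Omega1 O -> Omega1 O) : Prop :=
  {morph G : u v / u + v} /\
  exists F, pullback1 F /\ forall w, G w *+ p = F w.

(* G = phi^* / p^2 on 2-forms. *)
Definition divided_pullback2 (G : Omega2 O -> Omega2 O) : Prop :=
  {morph G : u v / u + v} /\
  exists F F2, pullback2 F F2 /\ forall w, G w *+ (p ^ 2) = F2 w.

End Pullback.
End Formal.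

Section Euler.
Variables (p : nat) (A : idomainType) (a1 a2 a3 : A).

Definition x1 : {mpoly A[3]} := 'X_(@Ordinal 3 0 isT).
Definition x2 : {mpoly A[3]} := 'X_(@Ordinal 3 1 isT).
Definition x3 : {mpoly A[3]} := 'X_(@Ordinal 3 2 isT).
Definition z1 : {mpoly A[2]} := 'X_(@Ordinal 2 0 isT).
Definition z2 : {mpoly A[2]} := 'X_(@Ordinal 2 1 isT).

Definition H1 : {mpoly A[3]} :=
  a1 *: x1 ^+ 2 + a2 *: x2 ^+ 2 + a3 *: x3 ^+ 2.
Definition H2 : {mpoly A[3]} := x1 ^+ 2 + x2 ^+ 2 + x3 ^+ 2.

Definition Npol : {mpoly A[2]} :=
  (z1 - a1 *: z2) * (z1 - a2 *: z2) * (z1 - a3 *: z2).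

Definition Fpol : {poly {mpoly A[2]}} :=
  ((a2 - a3)%:MP *: 'X^2 + (z1 - a2 *: z2)%:P) *
  ((a3 - a1)%:MP *: 'X^2 + (a1 *: z2 - z1)%:P).

Definition hasse : {mpoly A[2]} := (Fpol ^+ (p.-1)./2)`_(p.-1).

(* The value f(c1,c2), and the substitution f(h1,h2). *)
Definition ev2 (f : {mpoly A[2]}) (c1 c2 : A) : A :=
  f.@[fun i : 'I_2 => if i == 0 :> nat then c1 else c2].
Definition subst2 (f : {mpoly A[2]}) (h1 h2 : {mpoly A[3]}) : {mpoly A[3]} :=
  f \mPo [tuple h1; h2].

Definition Qpol : {mpoly A[3]} :=
  x1 * x2 * subst2 Npol H1 H2 * subst2 hasse H1 H2.

(* X, E_c^0 and S_{c2}^0 are Spec of (A[x1,x2,x3] / I) [1/Q], for I generated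
   respectively by the following polynomials. *)
Definition eqs_X : seq {mpoly A[3]} := [::].
Definition eqs_E (c1 c2 : A) : seq {mpoly A[3]} :=
  [:: H1 - c1%:MP; H2 - c2%:MP].
Definition eqs_S (c2 : A) : seq {mpoly A[3]} := [:: H2 - c2%:MP].

(* The three local expressions of omega_c, cleared of denominators; x1 and x2
   being invertible on E_c^0, the last one determines omega_c. *)
Definition is_omega c1 c2 (Y : formal_completion p (eqs_E c1 c2) Qpol)
    (O : forms Y) (w : Omega1 O) : Prop :=
  [/\ fn Y ((a2 - a3) *: (x2 * x3)) *: w = diff O (fn Y x1),
      fn Y ((a3 - a1) *: (x3 * x1)) *: w = diff O (fn Y x2) &
      fn Y ((a1 - a2) *: (x1 * x2)) *: w = diff O (fn Y x3)].

(* The three local expressions of eta_{c2}; each of the first two determines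
   eta_{c2} on S_{c2}^0. *)
Definition is_eta c2 (Y : formal_completion p (eqs_S c2) Qpol)
    (O : forms Y) (e : Omega2 O) : Prop :=
  let d f := diff O (fn Y f) in
  [/\ fn Y x1 *: e = wedge (d x2) (d x3),
      fn Y x2 *: e = wedge (d x3) (d x1) &
      fn Y x3 *: e = wedge (d x1) (d x2)].

(* phi_c and phi_c^*/p are uniquely determined by phi^X, since the restriction
   from X to E_c^0 is onto and 1-forms are generated by differentials of
   functions; the existential quantifiers only name them. *)
Definition fibre_congruence (deltaA : A -> A)
    (X : formal_completion p eqs_X Qpol)
    (phiX : {rmorphism fun_ring X -> fun_ring X})
    (E : forall c1 c2, formal_completion p (eqs_E c1 c2) Qpol)
    (OE : forall c1 c2, forms (E c1 c2))
    (resE : forall c1 c2, {rmorphism fun_ring X -> fun_ring (E c1 c2)}) :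
    Prop :=
  forall c1 c2 : A, deltaA c1 = 0 -> deltaA c2 = 0 ->
    ev2 Npol c1 c2 * ev2 hasse c1 c2 \is a GRing.unit ->
    exists (phi : {rmorphism fun_ring (E c1 c2) -> fun_ring (E c1 c2)})
           (G : Omega1 (OE c1 c2) -> Omega1 (OE c1 c2)),
      [/\ induces (resE c1 c2) phiX phi, divided_pullback1 phi G &
          forall w, is_omega w ->
            cong p (G w) (cst (E c1 c2) (ev2 hasse c1 c2)^-1 *: w)].

End Euler.

(* Main.v *)
(* The Euler field W (x1' = (a2-a3) x2 x3 and its cyclic permutations) kills H1
   and H2, is dual to omega_c on E_c, and satisfies dH1 /\ df = -2 W(f) eta on
   the sphere.  Write phi(x3) = x3^p + p y and theta = x3^(p-1) dx3 + dy, so that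
   phi^* dx3 = p theta.

   On E_c, dx3 = W(x3) omega_c, so the hypothesis on omega_c says that
     A_{p-1}(c) theta(W) = W(x3)^p  modulo p.
   On the sphere, apply phi^*/p^2 to -2 W(x3) eta = dH1 /\ dx3: since
   phi(H1) = H1^p, it follows that phi^*/p^2 eta = gamma eta with
     phi(W(x3)) gamma = H1^(p-1) theta(W).
   Hence gamma = H1^(p-1) / A_{p-1}(H1,c2) modulo p amounts to the vanishing
   modulo p of one function on the sphere, known on each curve H1 = c1 for c1 a
   Teichmueller lift with N A_{p-1} invertible.  These are enough curves: the ring
   A[x1,x2,x3]/(H2-c2) is free over A[h,u] (h = H1, u = x3^2) with basis the
   monomials with exponents 0 or 1, so that a function which vanishes for
   infinitely many residues of h vanishes. *)
From HB Require Import structures.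
Require Import Defs.
From mathcomp Require Import all_boot all_order all_algebra.
From mathcomp Require Import ring zify.
From mathcomp.multinomials Require Import ssrcomplements.
From Stdlib Require Import Classical ClassicalEpsilon.
Import GRing.Theory.
Local Open Scope ring_scope.
Set Implicit Arguments.
Unset Strict Implicit.
Unset Printing Implicit Defensive.

(** Two obstacles shape the argument. Dividing [phi^*] by p in a module of forms is ambiguous as
    long as p-torsion is not excluded there; so identities between forms are contracted with
    functionals whose values are functions, and p is cancelled in rings shown to have no p-torsion.
    Moreover y = delta x3 is only a function on the completion, whereas the passage from the curves
    to the sphere is a statement about polynomials. Modulo p^2, y is a fraction f/g with g a power
    of Q; this choice is made on X, so the same f and g serve the sphere and every curve, and both
    sides meet in one polynomial, [obstruction]. Sphere and curves are compared through a normal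
    form: once H2 = c2 is imposed, every x_i^2 is a polynomial in h and u, and a polynomial in the
    squares multiplies all coefficients of the normal form by the same scalar. Putting h = c1 in the
    coefficients for the sphere gives those for the curve. This yields both the absence of p-torsion
    and the comparison modulo p. *)

Definition multiple (V : zmodType) (m : nat) (x : V) : Prop :=
  exists w, x = w *+ m.

(** * Divisibility and congruences modulo an integer *)

Section Multiples.
Variable m : nat.

Lemma multiple0 (V : zmodType) : multiple m (0 : V).
Proof. by exists 0; rewrite mul0rn. Qed.

Lemma multipleD (V : zmodType) (x y : V) :
  multiple m x -> multiple m y -> multiple m (x + y).
Proof. by case=> u -> [v ->]; exists (u + v); rewrite mulrnDl. Qed.

Lemma multipleN (V : zmodType) (x : V) : multiple m x -> multiple m (- x).
Proof. by case=> u ->; exists (- u); rewrite mulNrn. Qed.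

Lemma multipleB (V : zmodType) (x y : V) :
  multiple m x -> multiple m y -> multiple m (x - y).
Proof. by move=> hx hy; apply: multipleD => //; apply: multipleN. Qed.

Lemma multipleMl (R : comPzRingType) (x y : R) :
  multiple m y -> multiple m (x * y).
Proof. by case=> u ->; exists (x * u); rewrite mulrnAr. Qed.

Lemma multipleMr (R : comPzRingType) (x y : R) :
  multiple m x -> multiple m (x * y).
Proof. by rewrite mulrC; apply: multipleMl. Qed.

Lemma multiple_sum (V : zmodType) (I : finType) (F : I -> V) :
  (forall i, multiple m (F i)) -> multiple m (\sum_i F i).
Proof.
move=> h; elim/big_ind: _ => //; [exact: multiple0 | exact: multipleD].
Qed.

Lemma multiple_cancel (R : comPzRingType) (u v x : R) :
  u * v = 1 -> multiple m (u * x) -> multiple m x.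
Proof.
by move=> uv /(multipleMl v); rewrite mulrA (mulrC v) uv mul1r.
Qed.

Lemma multiple_poly (R : nzRingType) (P : {poly R}) :
  (forall i, multiple m P`_i) -> multiple m P.
Proof.
move=> h; have [g hg] : exists g : nat -> R, forall i, P`_i = g i *+ m.
  exists (fun i => proj1_sig (constructive_indefinite_description _ (h i))).
  by move=> i; case: constructive_indefinite_description.
exists (\poly_(i < size P) g i); apply/polyP=> i.
rewrite coefMn coef_poly; case: ltnP => hi; first exact: hg.
by rewrite mul0rn nth_default.
Qed.

Lemma multiple_coef (R : nzRingType) (P : {poly R}) i :
  multiple m P -> multiple m P`_i.
Proof. by case=> g ->; exists g`_i; rewrite coefMn. Qed.

(** Write M g = m w and divide w by M, which the unit leading coefficient allows. Then M (g - m (w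
    div M)) = m (w mod M) has smaller size than M, so the factor g - m (w div M) vanishes. *)
Lemma multiple_mul_lead_unit (R : idomainType) (M g : {poly R}) :
  lead_coef M \is a GRing.unit -> multiple m (M * g) -> multiple m g.
Proof.
move=> uM [w hw]; exists (w %/ M)%R; apply/eqP; rewrite -subr_eq0.
have M0 : M != 0 by rewrite -lead_coef_eq0; apply: contraTneq uM => ->; rewrite unitr0.
have e : M * (g - (w %/ M) *+ m) = (w %% M)%R *+ m.
  rewrite mulrBr hw {1}(Pdiv.IdomainUnit.divp_eq uM w) mulrnDl mulrnAr (mulrC M).
  by rewrite addrAC subrr add0r.
set d := g - _; apply: contraT => d0.
have : (size (M * d)%R < size M)%N.
  rewrite e -mulr_natl -polyC_natr mul_polyC.
  by apply: leq_ltn_trans (size_scale_leq _ _) _; rewrite ltn_modp.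
rewrite size_mul //; move: d0; rewrite -size_poly_gt0.
by case: (size d) => // k _; rewrite addnS ltnNge leq_addr.
Qed.

(** This is the bound on the number of roots, read modulo m: a root is split off by the factor
    theorem, and at the other points the factor d - c is a unit and can be cancelled. *)
Lemma multiple_many_roots (R : comUnitRingType) (s : seq R) (P : {poly R}) :
  (size P <= size s)%N ->
  pairwise (fun c d => d - c \is a GRing.unit) s ->
  (forall c, c \in s -> multiple m P.[c]) -> multiple m P.
Proof.
elim: s P => [|c s IH] P /=.
  by rewrite leqn0 size_poly_eq0 => /eqP -> _ _; apply: multiple0.
move=> szP /andP [/allP us ps] hP.
have [P' eP] : exists P', P - P.[c]%:P = P' * ('X - c%:P).
  by apply/factor_theorem; rewrite /root !hornerE subrr.
have hc := hP c (mem_head _ _).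
have -> : P = P' * ('X - c%:P) + P.[c]%:P by rewrite -eP subrK.
apply: multipleD; last first.
  apply: multiple_poly => i; rewrite coefC; case: ifP => // _; exact: multiple0.
apply/multipleMr/IH => //.
  have [->|P'0] := eqVneq P' 0; first by rewrite size_poly0.
  have : (size (P - P.[c]%:P)%R <= (size s).+1)%N.
    apply: leq_trans (size_polyD _ _) _; rewrite geq_max szP size_polyN.
    exact: leq_trans (size_polyC_leq1 _) _.
  by rewrite eP size_Mmonic ?monicXsubC // size_XsubC addn2.
move=> d ds; have ud := us d ds.
apply: (multiple_cancel (divrr ud)); rewrite mulrC.
have -> : P'.[d] * (d - c) = P.[d] - P.[c].
  by have /(congr1 (horner^~ d)) := eP; rewrite !hornerE => <-.
by apply: multipleB => //; apply: hP; rewrite inE ds orbT.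
Qed.

End Multiples.

Lemma cong_refl (V : zmodType) m (x : V) : cong m x x.
Proof. by exists 0; rewrite subrr mul0rn. Qed.

Lemma cong_sym (V : zmodType) m (x y : V) : cong m x y -> cong m y x.
Proof. by move/multipleN; rewrite opprB. Qed.

Lemma cong_trans (V : zmodType) m (y x z : V) :
  cong m x y -> cong m y z -> cong m x z.
Proof. by move=> h /(multipleD h); rewrite addrA subrK. Qed.

Lemma congM (R : comPzRingType) m (x x' y y' : R) :
  cong m x x' -> cong m y y' -> cong m (x * y) (x' * y').
Proof.
rewrite /cong => hx hy; have -> : x * y - x' * y' = (x - x') * y + x' * (y - y') by ring.
by apply: multipleD; [apply: multipleMr | apply: multipleMl].
Qed.

Lemma congX (R : comPzRingType) m (x y : R) n :
  cong m x y -> cong m (x ^+ n) (y ^+ n).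
Proof.
by move=> h; elim: n => [|n IH]; [exact: cong_refl | rewrite !exprS; apply: congM].
Qed.

Lemma multiple_rmorph (R S : pzRingType) (f : {rmorphism R -> S}) m x :
  multiple m x -> multiple m (f x).
Proof. by case=> w ->; exists (f w); rewrite rmorphMn. Qed.

Lemma multiple_weaken (V : zmodType) m k (x : V) :
  multiple (m * k) x -> multiple m x.
Proof. by case=> w ->; exists (w *+ k); rewrite mulnC mulrnA. Qed.

(* In x^p - y^p = (x - y) (x^(p-1) + ... + y^(p-1)), the second factor is
   congruent to p y^(p-1) modulo p. *)
Lemma cong_expp (R : comPzRingType) p n (x y : R) :
  cong p x y -> cong (p ^ n.+1) (x ^+ (p ^ n)) (y ^+ (p ^ n)).
Proof.
move=> h; elim: n => [|n IH]; first by rewrite !expr1.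
rewrite !expnSr !exprM in IH *; have := congX (p ^ n) h.
move: (x ^+ _) (y ^+ _) IH => {h}x {}y h1 h.
rewrite /cong subrXX; set s := \sum_(i < p) _.
have [v ->] : multiple p s.
  have -> : s = \sum_(i < p) (x ^+ (p.-1 - i) * y ^+ i - y ^+ p.-1) + y ^+ p.-1 *+ p.
    by rewrite big_split /= sumr_const card_ord mulNrn subrK.
  apply: multipleD; last by exists (y ^+ p.-1).
  apply: multiple_sum => i.
  have {2}-> : (p.-1 = (p.-1 - i) + i)%N by have := ltn_ord i; lia.
  by rewrite exprD; apply: congM; [apply: congX | apply: cong_refl].
by case: h1 => w ->; exists (w * v); rewrite mulrnAr mulrnAl -mulrnA.
Qed.

(** * The base ring and its Teichmueller lifts *)

Section DiscreteValuationRing.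
Variables (p : nat) (A : idomainType).
Hypothesis A_dvr : dvr_with_uniformizer p A.

Lemma nonunit_multiple (a : A) : a \isn't a GRing.unit -> multiple p a.
Proof.
case: A_dvr => _ _ h na; have [->|a0] := eqVneq a 0; first exact: multiple0.
have [[|n] [u [uu ea]]] := h a a0; first by rewrite ea mulr1 uu in na.
by exists (u * p%:R ^+ n); rewrite ea exprSr mulrA mulr_natr.
Qed.

Lemma unit_not_multiple (a : A) : a \is a GRing.unit -> ~ multiple p a.
Proof.
case: A_dvr => _ np _ ua [w ea]; move: ua.
by rewrite ea -(mulr_natr w) unitrM (negPf np) andbF.
Qed.

Lemma two_unit : odd p -> (2%:R : A) \is a GRing.unit.
Proof.
move=> op; apply: contraT => /nonunit_multiple [w e2].
(* If 2 = p w, then 1 = p - 2 (p-1)/2 = p (1 - w (p-1)/2). *)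
case: (unit_not_multiple (unitr1 A)); exists (1 - w *+ p./2).
rewrite mulrnBl -mulrnA mulnC mulrnA -e2 -mulrnA -{1}(odd_double_half p) op.
by rewrite -muln2 [(2 * _)%N]mulnC mulrnDr addrK.
Qed.

Lemma mulrnp_inj (x : A) : x *+ p = 0 -> x = 0.
Proof.
case: A_dvr => p0 _ _ /eqP; rewrite -mulr_natr mulf_eq0 (negPf p0) orbF.
by move/eqP.
Qed.

Lemma multiple_separated (x : A) : (forall n, multiple (p ^ n) x) -> x = 0.
Proof.
case: A_dvr => p0 _ h hx; apply: NNPP => /eqP /h [n [u [uu ex]]].
case: (hx n.+1) => w; rewrite ex -(mulr_natr w) natrX exprS mulrA.
move/(mulIf (expf_neq0 n p0)) => eu; apply: (unit_not_multiple uu).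
by exists w; rewrite eu mulr_natr.
Qed.

(** The lift is the limit of s_n = b_n^(p^n), where b_n is an iterated p-th root of a modulo p.
    Since phi(s_n) and s_n^p agree modulo p^n, the limit l satisfies phi(l) = l^p, that is p
    delta(l) = 0. *)
Lemma teichmuller_lift (phiA : {rmorphism A -> A}) (deltaA : A -> A) :
  padically_complete p A -> perfect_residue_field p A ->
  attached p deltaA phiA ->
  forall a, exists c, cong p c a /\ deltaA c = 0.
Proof.
move=> complete perfect lift a.
pose g a := proj1_sig (constructive_indefinite_description _ (perfect a)).
have hg b : cong p b (g b ^+ p).
  by rewrite /g; case: constructive_indefinite_description.
pose b n := iter n g a; pose s n := b n ^+ (p ^ n).
have hs n : cong (p ^ n.+1) (s n.+1) (s n).
  have -> : s n.+1 = (b n.+1 ^+ p) ^+ (p ^ n) by rewrite /s expnS exprM.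
  apply: cong_expp; apply: cong_sym; exact: hg.
have [|l hl] := complete s.
  by move=> n; move: (hs n); rewrite expnSr => /multiple_weaken.
exists l; split.
  apply: (cong_trans (y := s 1)); first by have := hl 1; rewrite expn1.
  by have := hs 0; rewrite expn1 {2}/s expr1.
apply: mulrnp_inj; have := lift l; rewrite addrC => /eqP; rewrite -subr_eq => /eqP <-.
apply: multiple_separated => n.
apply: (cong_trans (y := phiA (s n))).
  by rewrite /cong -rmorphB; apply: multiple_rmorph; apply: hl.
apply: (cong_trans (y := s n ^+ p)); last by apply: congX; apply: cong_sym.
rewrite /s rmorphXn -exprM mulnC exprM.
suff : cong (p ^ n.+1) (phiA (b n) ^+ (p ^ n)) ((b n ^+ p) ^+ (p ^ n)).
  by rewrite expnSr => /multiple_weaken.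
by apply: cong_expp; rewrite lift; exists (deltaA (b n)); rewrite addrAC subrr add0r.
Qed.

End DiscreteValuationRing.

(** * Polynomials as combinations of squarefree monomials over squares *)

Section ParityComponents.
Variables (n : nat) (A R : comNzRingType) (iota : {rmorphism A -> R}).
Variable l : 'I_n -> R.

Definition parity (m : 'X_{1..n}) : {ffun 'I_n -> bool} := [ffun i => odd (m i)].

Definition half_power (m : 'X_{1..n}) : R := \prod_i l i ^+ (m i)./2.

(* A[x] is free over A[x_1^2, ..., x_n^2] with basis the monomials x^e with
   exponents e in {0, 1}; this is the coefficient of x^e, with l_i substituted
   for x_i^2. *)
Definition parity_comp (e : {ffun 'I_n -> bool}) (f : {mpoly A[n]}) : R :=
  \sum_(m <- msupp f) iota f@_m * (if parity m == e then half_power m else 0).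

(** The support varies with f; summing over all monomials below a common degree bound makes
    additivity and scaling termwise. *)
Lemma parity_compE e (f : {mpoly A[n]}) d : (msize f <= d)%N ->
  parity_comp e f =
  \sum_(m : 'X_{1..n < d})
    iota f@_m * (if parity m == e then half_power m else 0).
Proof.
move=> le; pose I : subFinType _ := 'X_{1..n < d}.
rewrite /parity_comp (big_mksub I) ?msupp_uniq //=; last first.
  by move=> m /msize_mdeg_lt /leq_trans; apply.
rewrite big_rmcond //= => m /memN_msupp_eq0 ->.
by rewrite rmorph0 mul0r.
Qed.

Lemma parity_compD e f g :
  parity_comp e (f + g) = parity_comp e f + parity_comp e g.
Proof.
pose d := maxn (msize (f + g)) (maxn (msize f) (msize g)).
rewrite !(parity_compE e (d := d)) ?leq_max ?leqnn ?orbT // -big_split /=.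
by apply: eq_bigr => m _; rewrite mcoeffD rmorphD mulrDl.
Qed.

Lemma parity_comp0 e : parity_comp e 0 = 0.
Proof. by rewrite /parity_comp msupp0 big_nil. Qed.

Lemma parity_compZ e c f : parity_comp e (c *: f) = iota c * parity_comp e f.
Proof.
pose d := maxn (msize (c *: f)) (msize f).
rewrite !(parity_compE e (d := d)) ?leq_max ?leqnn ?orbT // mulr_sumr.
by apply: eq_bigr => m _; rewrite mcoeffZ rmorphM mulrA.
Qed.

Lemma parity_compX e m :
  parity_comp e 'X_[m] = if parity m == e then half_power m else 0.
Proof.
by rewrite /parity_comp msuppX big_seq1 mcoeffX eqxx rmorph1 mul1r.
Qed.

Lemma parity_comp_sqr e i f :
  parity_comp e ('X_i ^+ 2 * f) = l i * parity_comp e f.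
Proof.
elim/mpolyind: f => [|c m f _ _ IH]; first by rewrite mulr0 parity_comp0 mulr0.
rewrite mulrDr !parity_compD IH mulrDr -scalerAr !parity_compZ mulrCA.
congr (_ * _ + _); rewrite mpolyXn -mpolyXD !parity_compX.
have -> : parity (U_(i) *+ 2 + m)%MM = parity m.
  apply/ffunP => j; rewrite !ffunE mnmDE mulmnE mnm1E oddD.
  by rewrite muln2 odd_double.
case: ifP => _; last by rewrite mulr0.
rewrite /half_power (bigD1 i) //= [in RHS](bigD1 i) //= mulrA -exprS.
congr (_ ^+ _ * _).
  by rewrite mnmDE mulmnE mnm1E eqxx.
apply: eq_bigr => j ji; rewrite mnmDE mulmnE mnm1E eq_sym (negPf ji).
by rewrite mul0n add0n.
Qed.

(** Polynomials in the squares multiply all components by one scalar. In particular an equation of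
    the curve or of the sphere acts by 0, so components depend only on f modulo the ideal. *)
Definition acts (P : {mpoly A[n]}) (r : R) : Prop :=
  forall e f, parity_comp e (P * f) = r * parity_comp e f.

Lemma acts_sqr i : acts ('X_i ^+ 2) (l i).
Proof. by move=> e f; apply: parity_comp_sqr. Qed.

Lemma actsC c : acts c%:MP (iota c).
Proof. by move=> e f; rewrite mul_mpolyC parity_compZ. Qed.

Lemma actsD P r Q s : acts P r -> acts Q s -> acts (P + Q) (r + s).
Proof. by move=> hP hQ e f; rewrite mulrDl parity_compD hP hQ mulrDl. Qed.

Lemma actsM P r Q s : acts P r -> acts Q s -> acts (P * Q) (r * s).
Proof. by move=> hP hQ e f; rewrite -mulrA hP hQ mulrA. Qed.

Lemma acts1 : acts 1 1.
Proof. by move=> e f; rewrite !mul1r. Qed.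

Lemma actsX P r k : acts P r -> acts (P ^+ k) (r ^+ k).
Proof.
by move=> h; elim: k => [|k IH]; [apply: acts1 | rewrite !exprS; apply: actsM].
Qed.

Lemma actsZ c P r : acts P r -> acts (c *: P) (iota c * r).
Proof. by rewrite -mul_mpolyC; apply/actsM/actsC. Qed.

Lemma actsN P r : acts P r -> acts (- P) (- r).
Proof.
by move/(actsZ (-1)); rewrite scaleN1r rmorphN1 mulN1r.
Qed.

(** Components determine [rho f] as soon as [psi] sends l_i to the true square of the image of x_i;
    divisibility of the components therefore passes to the coordinate ring. *)
Lemma parity_comp_expansion (C : comPzRingType) (rho : {rmorphism {mpoly A[n]} -> C})
    (psi : {rmorphism R -> C}) f :
  (forall c, psi (iota c) = rho c%:MP) ->
  (forall i, psi (l i) = rho ('X_i) ^+ 2) ->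
  rho f = \sum_(e : {ffun 'I_n -> bool}) (\prod_i rho 'X_i ^+ e i) * psi (parity_comp e f).
Proof.
move=> hC hl; elim/mpolyind: f => [|c m f _ _ IH].
  by rewrite rmorph0 big1 // => e _; rewrite parity_comp0 rmorph0 mulr0.
rewrite rmorphD IH -mul_mpolyC rmorphM -hC.
under [in RHS]eq_bigr => e _ do
  rewrite parity_compD mul_mpolyC parity_compZ rmorphD rmorphM mulrDr mulrCA parity_compX.
rewrite big_split /= -mulr_sumr; congr (_ * _ + _).
rewrite (bigD1 (parity m)) //= eqxx [X in _ + X]big1 ?addr0; last first.
  by move=> e /negPf; rewrite eq_sym => ->; rewrite rmorph0 mulr0.
rewrite /half_power rmorph_prod -big_split mpolyXE_id rmorph_prod.
apply: eq_bigr => i _ /=; rewrite !rmorphXn hl ffunE -exprM -exprD /=.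
by rewrite mul2n odd_double_half.
Qed.

End ParityComponents.

(** With g the evaluation at h = c1, this makes the components on a curve specializations of those
    on the sphere. *)
Lemma parity_comp_rmorph n (A R R' : comNzRingType) (iota : {rmorphism A -> R})
    (g : {rmorphism R -> R'}) (l : 'I_n -> R) e f :
  g (parity_comp iota l e f) = parity_comp (g \o iota) (g \o l) e f.
Proof.
rewrite /parity_comp rmorph_sum; apply: eq_bigr => m _; rewrite rmorphM.
congr (_ * _); rewrite (fun_if g) rmorph0; case: ifP => // _.
by rewrite /half_power rmorph_prod; under eq_bigr do rewrite rmorphXn.
Qed.

Lemma mpoly_ring_ind n (A : comNzRingType) (P : {mpoly A[n]} -> Prop) :
  (forall a, P a%:MP) -> (forall i, P 'X_i) ->
  (forall f g, P f -> P g -> P (f + g)) ->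
  (forall f g, P f -> P g -> P (f * g)) -> forall f, P f.
Proof.
move=> PC PX PD PM; elim/mpolyind => [|c m f _ _ Pf]; first exact: (PC 0).
apply: PD => //; rewrite -mul_mpolyC; apply: (PM) => //.
rewrite mpolyXE_id; apply: (big_ind P) => [|g h|i _]; [exact: (PC 1) | exact: PM |].
elim: (m i) => [|k IH]; first exact: (PC 1).
by rewrite exprS; apply: (PM).
Qed.

(** * Derivations and differential forms on formal completions *)

Section AdditiveMaps.
Variables (U V : zmodType) (g : U -> V).
Hypothesis gD : {morph g : u v / u + v}.

Lemma morphD0 : g 0 = 0.
Proof. by apply: (addrI (g 0)); rewrite -gD !addr0. Qed.

Lemma morphDN u : g (- u) = - g u.
Proof. by apply: (addrI (g u)); rewrite -gD !subrr morphD0. Qed.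

Lemma morphDMn u k : g (u *+ k) = g u *+ k.
Proof. by elim: k => [|k IH]; rewrite ?morphD0 // !mulrS gD IH. Qed.

Lemma morphDsum (I : finType) (F : I -> U) : g (\sum_i F i) = \sum_i g (F i).
Proof. exact: (big_morph g gD morphD0). Qed.

End AdditiveMaps.

Section Derivations.
Variables (k R : comPzRingType) (alg : k -> R) (M : lmodType R) (d : R -> M).
Hypothesis dP : derivation alg d.

Lemma derivationD x y : d (x + y) = d x + d y.
Proof. by case: dP. Qed.

Lemma derivationM x y : d (x * y) = x *: d y + y *: d x.
Proof. by case: dP. Qed.

Lemma derivation_alg a : d (alg a) = 0.
Proof. by case: dP. Qed.

Lemma derivation0 : d 0 = 0.
Proof. exact/morphD0/derivationD. Qed.

Lemma derivationN x : d (- x) = - d x.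
Proof. exact/morphDN/derivationD. Qed.

Lemma derivationMn x m : d (x *+ m) = d x *+ m.
Proof. exact/morphDMn/derivationD. Qed.

Lemma derivation1 : d 1 = 0.
Proof.
by apply: (addrI (d 1)); rewrite addr0 -{3}(mulr1 1) derivationM scale1r.
Qed.

Lemma derivationX x m : d (x ^+ m) = (x ^+ m.-1 *: d x) *+ m.
Proof.
case: m => [|m]; first by rewrite derivation1.
elim: m => [|m IH]; first by rewrite expr1 expr0 scale1r.
by rewrite exprS derivationM IH /= -scalerMnr scalerA -exprS [RHS]mulrSr.
Qed.

Lemma derivation_mpoly n (A : comNzRingType) (rho : {rmorphism {mpoly A[n]} -> R}) f :
  (forall a, d (rho a%:MP) = 0) ->
  d (rho f) = \sum_i rho f^`M(i) *: d (rho 'X_i).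
Proof.
move=> d0; elim/mpoly_ring_ind: f => [a|i|f g hf hg|f g hf hg].
- by rewrite d0 big1 // => i _; rewrite mderivC rmorph0 scale0r.
- rewrite (bigD1 i) //= big1 => [|j ji]; rewrite mderivX mnm1E.
    by rewrite eqxx -[X in (X - _)%MM]add0m addmK mpolyX0 scale1r rmorph1 scale1r addr0.
  by rewrite eq_sym (negPf ji) scale0r rmorph0 scale0r.
- rewrite rmorphD derivationD hf hg -big_split; apply: eq_bigr => i _.
  by rewrite linearD rmorphD scalerDl.
rewrite rmorphM derivationM hf hg !scaler_sumr -big_split; apply: eq_bigr => i _.
by rewrite mderivM rmorphD !rmorphM scalerDl !scalerA /= addrC (mulrC (rho g)).
Qed.

End Derivations.

Section VectorFields.
Variables (n : nat) (A : comNzRingType) (w : 'I_n -> {mpoly A[n]}).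

Definition vector_field (f : {mpoly A[n]}) : {mpoly A[n]} :=
  \sum_i f^`M(i) * w i.

Lemma vector_fieldD f g : vector_field (f + g) = vector_field f + vector_field g.
Proof.
by rewrite /vector_field -big_split; apply: eq_bigr => i _; rewrite linearD mulrDl.
Qed.

Lemma vector_fieldM f g :
  vector_field (f * g) = f * vector_field g + g * vector_field f.
Proof.
rewrite /vector_field !mulr_sumr -big_split; apply: eq_bigr => i _ /=.
by rewrite mderivM; ring.
Qed.

Lemma vector_fieldC a : vector_field a%:MP = 0.
Proof. by rewrite /vector_field big1 // => i _; rewrite mderivC mul0r. Qed.

Lemma vector_field_derivation :
  derivation (mpolyC n (R := A)) (vector_field : _ -> {mpoly A[n]}^o).
Proof.
by split; [exact: vector_fieldD | exact: vector_fieldM | exact: vector_fieldC].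
Qed.

Lemma vector_fieldMn f m : vector_field (f *+ m) = vector_field f *+ m.
Proof. exact: (derivationMn vector_field_derivation). Qed.

Lemma vector_fieldB f g : vector_field (f - g) = vector_field f - vector_field g.
Proof. by rewrite vector_fieldD (derivationN vector_field_derivation). Qed.

Lemma vector_field_sum (I : finType) (F : I -> {mpoly A[n]}) :
  vector_field (\sum_i F i) = \sum_i vector_field (F i).
Proof. exact: (morphDsum vector_fieldD). Qed.

Lemma vector_fieldX i : vector_field 'X_i = w i.
Proof.
rewrite /vector_field (bigD1 i) //= big1 => [|j ji]; rewrite mderivX mnm1E.
  by rewrite eqxx -[X in (X - _)%MM]add0m addmK mpolyX0 scale1r mul1r addr0.
by rewrite eq_sym (negPf ji) scale0r mul0r.
Qed.

End VectorFields.

(** * Functions on a formal completion and their p-torsion *)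

Section FormalCompletion.
Variables (p : nat) (A : idomainType) (gs : seq {mpoly A[3]}) (q : {mpoly A[3]}).
Variable Y : formal_completion p gs q.

HB.instance Definition _ :=
  GRing.RMorphism.copy (@fn p A gs q Y) (completion_map Y \o coord_map Y).

Definition red_fn n (f : {mpoly A[3]}) : red Y n := red_map Y n (coord_map Y f).

HB.instance Definition _ n :=
  GRing.RMorphism.copy (red_fn n) (red_map Y n \o coord_map Y).

Lemma proj_fn n f : proj Y n (fn Y f) = red_fn n f.
Proof. exact: completion_mapP. Qed.

Lemma coord_unit : exists v, coord_map Y q * v = 1.
Proof. by case: (coordP Y). Qed.

Lemma red_unit n : exists v, red_fn n q * v = 1.
Proof.
case: coord_unit => v e; exists (red_map Y n v).
by rewrite /red_fn -rmorphM e rmorph1.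
Qed.

Lemma fn_unit : exists v, fn Y q * v = 1.
Proof.
case: coord_unit => v e; exists (completion_map Y v).
by rewrite /fn -rmorphM e rmorph1.
Qed.

Lemma coord_fraction b : exists f k, b * coord_map Y q ^+ k = coord_map Y f.
Proof.
by case: (coordP Y) => _ h _; case: (h b) => f [k e]; exists f, k.
Qed.

Lemma coord_map_eq0 f :
  coord_map Y f = 0 <-> exists k, in_ideal gs (q ^+ k * f).
Proof. by case: (coordP Y). Qed.

Lemma coord_map_eq i : coord_map Y gs`_i = 0.
Proof.
have [hi|hi] := ltnP i (size gs); last by rewrite nth_default ?rmorph0.
apply/coord_map_eq0; exists 0, (fun j => (val j == i)%:R).
rewrite expr0 mul1r (bigD1 (Ordinal hi)) //= eqxx mul1r big1 ?addr0 // => j.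
by rewrite -val_eqE /= => /negPf ->; rewrite mul0r.
Qed.

Lemma red_map_eq0 n b : red_map Y n b = 0 <-> multiple (p ^ n) b.
Proof. by case: (redP Y n) => _ ->; rewrite /cong subr0. Qed.

Lemma red_lift n (s : red Y n) : exists b, red_map Y n b = s.
Proof. by case: (redP Y n). Qed.

Lemma red_mulrn n (s : red Y n) : s *+ p ^ n = 0.
Proof. by case: (red_lift s) => b <-; rewrite -rmorphMn; apply/red_map_eq0; exists b. Qed.

Lemma red_fraction n (s : red Y n) :
  exists f k, s * red_fn n q ^+ k = red_fn n f.
Proof.
case: (red_lift s) => b <-; case: (coord_fraction b) => f [k e]; exists f, k.
by rewrite /red_fn -e rmorphM rmorphXn.
Qed.

Lemma proj_inj (x y : fun_ring Y) : (forall n, proj Y n x = proj Y n y) -> x = y.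
Proof.
move=> h; case: (projP Y) => ht /(_ (fun n => proj Y n y)).
case=> [n|z [_ hz]]; first exact: ht.
by rewrite -(hz x h) -(hz y).
Qed.

(* Lifts b_m of x modulo p^m satisfy b_(m+1) = b_m + p^m e_m and b_n = p^n e,
   so x = p^n (e + e_n + p e_(n+1) + ...). *)
Lemma proj_eq0 n x : proj Y n x = 0 -> multiple (p ^ n) x.
Proof.
case: (projP Y) => ht hl x0.
pose b m := proj1_sig (constructive_indefinite_description _ (red_lift (proj Y m x))).
have hb m : red_map Y m (b m) = proj Y m x.
  by rewrite /b; case: constructive_indefinite_description.
have he m : multiple (p ^ m) (b m.+1 - b m).
  by apply/red_map_eq0; rewrite rmorphB -transP !hb ht subrr.
pose e m := proj1_sig (constructive_indefinite_description _ (he m)).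
have eE m : b m.+1 - b m = e m *+ p ^ m.
  by rewrite /e; case: constructive_indefinite_description.
have [e0 e0E] : multiple (p ^ n) (b n) by apply/red_map_eq0; rewrite hb.
have bS m : b (n + m)%N = (e0 + \sum_(j < m) e (n + j)%N *+ p ^ j) *+ p ^ n.
  elim: m => [|m IH]; first by rewrite addn0 big_ord0 addr0.
  rewrite addnS -(subrK (b (n + m)%N) (b _.+1)) eE IH big_ord_recr /= addrA.
  by rewrite addrC [RHS]mulrnDl expnD mulnC mulrnA.
have hb2 m k : red_map Y m (b (k + m)%N) = proj Y m x.
  elim: k => [|k IH]; first by rewrite add0n hb.
  rewrite addSn -(subrK (b (k + m)%N) (b _.+1)) rmorphD IH eE expnD mulrnA rmorphMn.
  by rewrite red_mulrn add0r.
pose z m := red_map Y m (e0 + \sum_(j < m) e (n + j)%N *+ p ^ j).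
have [m|y [hy _]] := hl z.
  by rewrite /z transP big_ord_recr addrA rmorphD rmorphMn red_mulrn addr0.
exists y; apply: proj_inj => m.
by rewrite rmorphMn hy /z -rmorphMn -bS hb2.
Qed.

Hypothesis coord_torsionfree : forall b : Defs.coord Y, b *+ p = 0 -> b = 0.

(** One level is lost: if p x = 0 and b lifts x modulo p^(n+1), then p^(n+1) divides p b, so p^n
    divides b and x vanishes modulo p^n. *)
Lemma fun_ring_torsionfree (x : fun_ring Y) : x *+ p = 0 -> x = 0.
Proof.
move=> x0; apply: proj_inj => n; rewrite rmorph0.
case: (projP Y) => <- _; case: (red_lift (proj Y n.+1 x)) => b hb.
have [w] : multiple (p ^ n.+1) (b *+ p).
  by apply/red_map_eq0; rewrite rmorphMn hb -rmorphMn x0 rmorph0.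
move/eqP; rewrite -subr_eq0 expnSr mulrnA -mulrnBl => /eqP /coord_torsionfree /eqP.
rewrite subr_eq0 => /eqP bE.
by rewrite -hb transP; apply/red_map_eq0; exists w.
Qed.

(** Here an identity known only after multiplication by p, and only modulo p^2, becomes a congruence
    modulo p. *)
Lemma red2_torsion f : red_fn 2 f *+ p = 0 -> multiple p (coord_map Y f).
Proof.
rewrite /red_fn -rmorphMn => /red_map_eq0 [w].
move/eqP; rewrite -subr_eq0 expnSr expn1 mulrnA -mulrnBl => /eqP /coord_torsionfree /eqP.
by rewrite subr_eq0 => /eqP ->; exists w.
Qed.

End FormalCompletion.

(** * Linear maps out of modules of forms *)

Section LinearExtension.
Variables (R : comPzRingType) (M N : lmodType R).

Lemma linear_fun_add (v : M -> N) : linear v -> {morph v : x y / x + y}.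
Proof. by move=> lv x y; rewrite -{1}(scale1r x) lv scale1r. Qed.

Lemma linear_fun_scale (v : M -> N) a x : linear v -> v (a *: x) = a *: v x.
Proof.
move=> lv; rewrite -{1}(addr0 (a *: x)) lv.
by rewrite (morphD0 (linear_fun_add lv)) addr0.
Qed.

Lemma kaehler_ext (k : comPzRingType) (alg : k -> R) (d : R -> M) (u v : M -> N) :
  kaehler_differentials alg d -> linear u -> linear v ->
  (forall x, u (d x) = v (d x)) -> u =1 v.
Proof.
move=> [dP univ] lu lv uv.
pose U : {linear M -> N} := HB.pack u (GRing.isLinear.Build R M N *:%R u lu).
pose V : {linear M -> N} := HB.pack v (GRing.isLinear.Build R M N *:%R v lv).
have [|W [_ hW]] := univ N (v \o d).
  split=> [x y|x y|a] /=.
  - by rewrite (derivationD dP) (linear_fun_add lv).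
  - by rewrite (derivationM dP) (linear_fun_add lv) !(linear_fun_scale _ _ lv).
  - by rewrite (derivation_alg dP) (morphD0 (linear_fun_add lv)).
by move=> x; exact: etrans (hW U uv x) (esym (hW V (fun=> erefl) x)).
Qed.

End LinearExtension.

Lemma exterior_square_ext (R : comPzRingType) (M N P : lmodType R)  (wedge : M -> M -> N)
  (u v : N -> P) :
  exterior_square wedge -> linear u -> linear v ->
  (forall x y, u (wedge x y) = v (wedge x y)) -> u =1 v.
Proof.
move=> [[wl wr wa] univ] lu lv uv.
pose U : {linear N -> P} := HB.pack u (GRing.isLinear.Build R N P *:%R u lu).
pose V : {linear N -> P} := HB.pack v (GRing.isLinear.Build R N P *:%R v lv).
have [|W [_ hW]] := univ P (fun x y => v (wedge x y)).
  split=> [a x x' y|a x y y'|x].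
  - by rewrite wl lv.
  - by rewrite wr lv.
  - by rewrite wa (morphD0 (linear_fun_add lv)).
by move=> x; exact: etrans (hW U uv x) (esym (hW V (fun _ _ => erefl) x)).
Qed.

Section Wedge.
Variables (R : comPzRingType) (M N : lmodType R) (wedge : M -> M -> N).
Hypothesis wedgeP : alternating_bilinear wedge.

Lemma wedgeDl u u' v : wedge (u + u') v = wedge u v + wedge u' v.
Proof. by case: wedgeP => h _ _; rewrite -{1}(scale1r u) h scale1r. Qed.

Lemma wedgeDr u v v' : wedge u (v + v') = wedge u v + wedge u v'.
Proof. by case: wedgeP => _ h _; rewrite -{1}(scale1r v) h scale1r. Qed.

Lemma wedge0l v : wedge 0 v = 0.
Proof. exact: (morphD0 (fun u u' => wedgeDl u u' v)). Qed.

Lemma wedge0r u : wedge u 0 = 0.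
Proof. exact: (morphD0 (wedgeDr u)). Qed.

Lemma wedgeZl a u v : wedge (a *: u) v = a *: wedge u v.
Proof. by case: wedgeP => h _ _; rewrite -{1}(addr0 (a *: u)) h wedge0l addr0. Qed.

Lemma wedgeZr a u v : wedge u (a *: v) = a *: wedge u v.
Proof. by case: wedgeP => _ h _; rewrite -{1}(addr0 (a *: v)) h wedge0r addr0. Qed.

Lemma wedgeMnl u v k : wedge (u *+ k) v = wedge u v *+ k.
Proof. exact: (morphDMn (fun u u' => wedgeDl u u' v)). Qed.

Lemma wedgeMnr u v k : wedge u (v *+ k) = wedge u v *+ k.
Proof. exact: (morphDMn (wedgeDr u)). Qed.

Lemma wedgevv u : wedge u u = 0.
Proof. by case: wedgeP. Qed.

Lemma wedgeC u v : wedge u v = - wedge v u.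
Proof.
apply/eqP; rewrite -subr_eq0 opprK; apply/eqP.
by have := wedgevv (u + v); rewrite wedgeDl !wedgeDr !wedgevv add0r addr0.
Qed.

End Wedge.

(** * Tangent vector fields on the reductions modulo p^n *)

Section RedDerivation.
Variables (p : nat) (A : idomainType) (gs : seq {mpoly A[3]}) (q : {mpoly A[3]}).
Variable Y : formal_completion p gs q.

Lemma red_unit_cancel n k (s t : red Y n) :
  s * red_fn Y n q ^+ k = t * red_fn Y n q ^+ k -> s = t.
Proof.
case: (red_unit Y n) => v hv /(congr1 (fun z => z * v ^+ k)).
by rewrite -!mulrA -exprMn hv expr1n !mulr1.
Qed.

Lemma red_fraction2 n (s t : red Y n) : exists f g k,
  s * red_fn Y n q ^+ k = red_fn Y n f /\ t * red_fn Y n q ^+ k = red_fn Y n g.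
Proof.
case: (red_fraction s) => f [k hf]; case: (red_fraction t) => g [l hg].
exists (f * q ^+ l), (g * q ^+ k), (k + l)%N.
by split; rewrite rmorphM rmorphXn /= -?hf -?hg exprD; ring.
Qed.

(** Every element is a polynomial divided by a power of the unit q, and the product rule carries the
    vanishing over to such a quotient. *)
Lemma red_derivation_eq0 n (M : lmodType (red Y n)) (d : red Y n -> M) :
  derivation (red_cst Y n) d ->
  (forall i : 'I_3, d (red_fn Y n 'X_i) = 0) -> forall s, d s = 0.
Proof.
move=> dP dX s; have d0 f : d (red_fn Y n f) = 0.
  rewrite (derivation_mpoly dP); first by rewrite big1 // => i _; rewrite dX scaler0.
  exact: (derivation_alg dP).
case: (red_fraction s) => f [k /(congr1 d)].
rewrite (derivationM dP) d0 -rmorphXn d0 scaler0 add0r rmorphXn /=.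
case: (red_unit Y n) => v hv /(congr1 (fun z => v ^+ k *: z)).
by rewrite scaler0 scalerA mulrC -exprMn hv expr1n scale1r.
Qed.

Variable w : 'I_3 -> {mpoly A[3]}.
Hypothesis w_gs : forall i : 'I_(size gs), vector_field w gs`_i = 0.
Let W := vector_field w.

(* If q^k f = sum h_i g_i, then q^k W f = sum g_i W h_i - f W(q^k). *)
Lemma coord_vector_field f : coord_map Y f = 0 -> coord_map Y (W f) = 0.
Proof.
move=> f0; case/coord_map_eq0: (f0) => k [h e].
have : coord_map Y (W (q ^+ k * f)) = 0.
  rewrite e /W vector_field_sum rmorph_sum big1 // => i _.
  by rewrite vector_fieldM w_gs mulr0 add0r rmorphM coord_map_eq mul0r.
rewrite /W vector_fieldM rmorphD !rmorphM f0 mul0r addr0 rmorphXn.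
case: (coord_unit Y) => v hv /(congr1 (fun z => v ^+ k * z)).
by rewrite mulr0 mulrA -exprMn [v * _]mulrC hv expr1n mul1r.
Qed.

Lemma red_vector_field n f : red_fn Y n f = 0 -> red_fn Y n (W f) = 0.
Proof.
move=> f0; case/red_map_eq0: (f0) => b eb; case: (coord_fraction b) => g [k hg].
have : coord_map Y (f * q ^+ k - g *+ p ^ n) = 0.
  by rewrite rmorphB rmorphMn rmorphM rmorphXn eb -hg mulrnAl subrr.
move/coord_vector_field/(congr1 (red_map Y n)).
rewrite -/(red_fn Y n _) rmorph0 /W vector_fieldB vector_fieldMn vector_fieldM.
rewrite rmorphB rmorphMn red_mulrn subr0 rmorphD !rmorphM /= f0 mul0r add0r rmorphXn /=.
by rewrite mulrC => h; apply: (@red_unit_cancel n k); rewrite h mul0r.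
Qed.

(** The value at s = f/q^k is prescribed by the quotient rule, D s q^k + s W(q^k) = W f, imposed for
    all representations of s at once. Independence of the representation is then settled once, and
    the sum and product rules follow over a common denominator. *)
Lemma red_derivation n : exists D : red Y n -> (red Y n)^o,
  derivation (red_cst Y n) D /\ forall f, D (red_fn Y n f) = red_fn Y n (W f).
Proof.
have [D hD] : exists D : red Y n -> red Y n, forall s f k,
    s * red_fn Y n q ^+ k = red_fn Y n f ->
    D s * red_fn Y n q ^+ k + s * red_fn Y n (W (q ^+ k)) = red_fn Y n (W f).
  suff h (s : red Y n) : exists t, forall f k,
      s * red_fn Y n q ^+ k = red_fn Y n f ->
      t * red_fn Y n q ^+ k + s * red_fn Y n (W (q ^+ k)) = red_fn Y n (W f).
    exists (fun s => proj1_sig (constructive_indefinite_description _ (h s))).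
    by move=> s; case: constructive_indefinite_description.
  case: (red_fraction s) => f0 [k0 h0]; case: (red_unit Y n) => v hv.
  exists (v ^+ k0 * (red_fn Y n (W f0) - s * red_fn Y n (W (q ^+ k0)))) => f k h.
  set t := v ^+ k0 * _.
  have ht : t * red_fn Y n q ^+ k0 + s * red_fn Y n (W (q ^+ k0)) = red_fn Y n (W f0).
    by rewrite /t mulrC mulrA -exprMn hv expr1n mul1r subrK.
  have : red_fn Y n (f * q ^+ k0 - f0 * q ^+ k) = 0.
    by rewrite rmorphB !rmorphM !rmorphXn /= -h -h0 mulrAC subrr.
  move/red_vector_field; rewrite /W vector_fieldB !vector_fieldM rmorphB !rmorphD !rmorphM.
  rewrite -/W !rmorphXn /= -h -h0 -ht => e.
  apply: (@red_unit_cancel n k0); apply/eqP; rewrite -subr_eq0; apply/eqP.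
  by rewrite -[RHS]oppr0 -e; ring.
exists D; have Dfn f : D (red_fn Y n f) = red_fn Y n (W f).
  have := hD (red_fn Y n f) f 0; rewrite expr0 !mulr1 expr0 => /(_ erefl) <-.
  by rewrite /W -[1]/(1%:MP) vector_fieldC rmorph0 mulr0 addr0.
split=> //; split=> [s t|s t|a].
- case: (red_fraction2 s t) => f [g [k [hs ht]]].
  have hst : (s + t) * red_fn Y n q ^+ k = red_fn Y n (f + g).
    by rewrite mulrDl hs ht rmorphD.
  apply: (@red_unit_cancel n k); apply: (addIr ((s + t) * red_fn Y n (W (q ^+ k)))).
  rewrite (hD _ _ _ hst) /W vector_fieldD rmorphD /= -/W -(hD _ _ _ hs) -(hD _ _ _ ht).
  ring.
- case: (red_fraction2 s t) => f [g [k [hs ht]]].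
  have hst : (s * t) * red_fn Y n q ^+ (k + k) = red_fn Y n (f * g).
    by rewrite exprD rmorphM /= -hs -ht; ring.
  apply: (@red_unit_cancel n (k + k)).
  apply: (addIr ((s * t) * red_fn Y n (W (q ^+ (k + k))))).
  rewrite (hD _ _ _ hst) /W !exprD !vector_fieldM !rmorphD !rmorphM !rmorphXn /= -/W.
  rewrite -(hD _ _ _ hs) -(hD _ _ _ ht) -hs -ht.
  rewrite /GRing.scale /=; ring.
- have := Dfn a%:MP; rewrite /W vector_fieldC rmorph0; exact.
Qed.

End RedDerivation.

Section Forms.
Variables (p : nat) (A : idomainType) (gs : seq {mpoly A[3]}) (q : {mpoly A[3]}).
Variables (Y : formal_completion p gs q) (O : forms Y).

Lemma Omega_projD n : {morph @Omega_proj _ _ _ _ _ O n : u v / u + v}.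
Proof. by case: (Omega_proj_semilinear O n). Qed.

Lemma Omega_projZ n a u : Omega_proj n (a *: u) = proj Y n a *: Omega_proj (f := O) n u.
Proof. by case: (Omega_proj_semilinear O n). Qed.

Lemma Omega_proj_inj (u v : Omega1 O) :
  (forall n, Omega_proj n u = Omega_proj n v) -> u = v.
Proof.
move=> h; case: (Omega_projP O) => ht /(_ (fun n => Omega_proj n v)).
case=> [n|z [_ hz]]; first exact: ht.
by rewrite -(hz u h) -(hz v).
Qed.

Lemma d_red_derivation n : derivation (red_cst Y n) (@d_red _ _ _ _ _ O n).
Proof. by case: (d_redP O n). Qed.

Lemma diff_derivation : derivation (cst Y) (diff O).
Proof.
split=> [x y|x y|a]; apply: Omega_proj_inj => n.
- by rewrite Omega_projD !diffP rmorphD (derivationD (d_red_derivation n)).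
- by rewrite Omega_projD !Omega_projZ !diffP rmorphM (derivationM (d_red_derivation n)).
rewrite diffP (morphD0 (@Omega_projD n)) /cst proj_fn.
exact: (derivation_alg (d_red_derivation n)).
Qed.

(** This is the contraction of 1-forms with a tangent vector field. *)
Lemma red_functional n w :
  (forall i : 'I_(size gs), vector_field w gs`_i = 0) ->
  exists l : {linear Omega_red O n -> (red Y n)^o},
    forall f, l (d_red O (red_fn Y n f)) = red_fn Y n (vector_field w f).
Proof.
move=> hw; case: (red_derivation Y hw n) => D [DP Df].
case: (d_redP O n) => _ /(_ _ _ DP) [l [hl _]]; exists l.
by move=> f; rewrite hl Df.
Qed.

End Forms.

(** * The coordinate rings of the curves and of the spheres *)

Section ParityPresentation.
Variables (p : nat) (A : idomainType) (gs : seq {mpoly A[3]}) (q : {mpoly A[3]}).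
Variable Y : formal_completion p gs q.
Variables (R : comNzRingType) (iota : {rmorphism A -> R}) (l : 'I_3 -> R).
Variable psi : {rmorphism R -> Defs.coord Y}.
Hypothesis psi_iota : forall c, psi (iota c) = coord_map Y c%:MP.
Hypothesis psi_l : forall i, psi (l i) = coord_map Y 'X_i ^+ 2.
Hypothesis gs_acts : forall i : 'I_(size gs), acts iota l gs`_i 0.

Lemma parity_comp_ideal e f g : in_ideal gs f -> parity_comp iota l e (g * f) = 0.
Proof.
case=> h ->; rewrite mulr_sumr (morphDsum (parity_compD iota l e)) big1 // => i _.
by rewrite mulrA mulrC gs_acts mul0r.
Qed.

Lemma parity_comp_multiple f :
  (forall e, multiple p (parity_comp iota l e f)) -> multiple p (coord_map Y f).
Proof.
move=> h; rewrite (parity_comp_expansion f psi_iota psi_l).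
apply: multiple_sum => e; apply: multipleMl.
exact: multiple_rmorph.
Qed.

(** If p f = 0 in the coordinate ring, some q^j p f lies in the ideal, so p kills the components of
    q^j f. These vanish because [R] has no p-torsion, and the expansion gives q^j f = 0. *)
Lemma parity_coord_torsionfree :
  (forall r : R, r *+ p = 0 -> r = 0) -> forall b : Defs.coord Y, b *+ p = 0 -> b = 0.
Proof.
move=> Rp b bp; case: (coord_fraction b) => f [k hf].
have /coord_map_eq0 [j hj] : coord_map Y (f *+ p) = 0.
  by rewrite rmorphMn -hf -mulrnAl bp mul0r.
have : coord_map Y (q ^+ j * f) = 0.
  rewrite (parity_comp_expansion _ psi_iota psi_l) big1 // => e _.
  rewrite [parity_comp _ _ _ _]Rp ?rmorph0 ?mulr0 //.
  rewrite -(morphDMn (parity_compD iota l e)) -mulrnAr -[_ * _]mul1r.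
  exact: parity_comp_ideal.
case: (coord_unit Y) => v hv; rewrite rmorphM rmorphXn -hf mulrCA -exprD => e; apply/esym.
by rewrite -(mul0r (v ^+ (j + k))) -e -mulrA -exprMn hv expr1n mulr1.
Qed.

End ParityPresentation.

Lemma acts_rmorph (A R R' : comNzRingType) (iota : {rmorphism A -> R})
    (g : {rmorphism R -> R'}) n (l : 'I_n -> R) (P : {mpoly A[n]}) r :
  acts iota l P r -> acts (g \o iota) (g \o l) P (g r).
Proof.
move=> h e f; have := congr1 g (h e f).
rewrite rmorphM !parity_comp_rmorph; exact.
Qed.

(** * Normal forms on the sphere and the curves in terms of H1 and x3^2 *)

Section EulerRings.
Variables (p : nat) (A : idomainType) (a1 a2 a3 : A).
Hypotheses (A_dvr : dvr_with_uniformizer p A).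
Hypothesis a_unit : (a1 - a2) * (a2 - a3) * (a3 - a1) \is a GRing.unit.
Variable c2 : A.
Local Notation q := (Qpol p a1 a2 a3).
Local Notation H1 := (H1 a1 a2 a3).
Local Notation H2 := (H2 A).
Local Notation x1 := (x1 A).
Local Notation x2 := (x2 A).
Local Notation x3 := (x3 A).

Lemma a12_unit : a1 - a2 \is a GRing.unit.
Proof. by move: a_unit; rewrite !unitrM => /andP [/andP []]. Qed.

Lemma a23_unit : a2 - a3 \is a GRing.unit.
Proof. by move: a_unit; rewrite !unitrM => /andP [/andP []]. Qed.

Lemma a31_unit : a3 - a1 \is a GRing.unit.
Proof. by move: a_unit; rewrite !unitrM => /andP [/andP []]. Qed.

(** For x3^2 = u, the equations H1 = h and H2 = c2 form a linear system in x1^2 and x2^2 with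
    determinant a1 - a2. *)
Let b : A := (a1 - a2)^-1.

Let hb : b * (a1 - a2) = 1.
Proof. exact: mulVr a12_unit. Qed.

Let iota : {rmorphism A -> {poly {poly A}}} := polyC \o polyC.

(* The squares x_i^2 in terms of h = H1, u = x3^2 and the constant c2 = H2. *)
Definition squares (h u : {poly {poly A}}) (i : 'I_3) : {poly {poly A}} :=
  match val i with
  | 0 => iota b * (h - iota (a2 * c2) - iota (a3 - a2) * u)
  | 1 => iota b * (iota (a1 * c2) + iota (a3 - a1) * u - h)
  | _ => u
  end.

Let l := squares 'X%:P 'X.
Let i1 := @Ordinal 3 0 isT.
Let i2 := @Ordinal 3 1 isT.
Let i3 := @Ordinal 3 2 isT.

Lemma squares_sum h u :
  squares h u i1 + squares h u i2 + squares h u i3 = iota c2.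
Proof.
rewrite /squares /=; have e := congr1 iota hb.
move: e; rewrite !(rmorphM, rmorphB, rmorph1) /= => e.
set B := _%:P%:P in e *; set C := c2%:P%:P.
transitivity (B * (a1%:P%:P - a2%:P%:P) * C + (1 - B * (a1%:P%:P - a2%:P%:P)) * u).
  ring.
by rewrite e; ring.
Qed.

Lemma squares_wsum h u :
  iota a1 * squares h u i1 + iota a2 * squares h u i2 + iota a3 * squares h u i3 = h.
Proof.
rewrite /squares /=; have e := congr1 iota hb.
move: e; rewrite !(rmorphM, rmorphB, rmorph1) /= => e.
set B := _%:P%:P in e *; set C := c2%:P%:P.
transitivity (B * (a1%:P%:P - a2%:P%:P) * h + (1 - B * (a1%:P%:P - a2%:P%:P)) *
  (a3%:P%:P * u)).
  ring.
by rewrite e; ring.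
Qed.

Lemma acts_H2 : acts iota l H2 (iota c2).
Proof.
rewrite -(squares_sum 'X%:P 'X) /Defs.H2.
by do 2?apply: actsD; apply: acts_sqr.
Qed.

Lemma acts_H1 : acts iota l H1 'X%:P.
Proof.
rewrite -[X in acts _ _ _ X](squares_wsum 'X%:P 'X) /Defs.H1.
by do 2?apply: actsD; apply/actsZ/acts_sqr.
Qed.

Let ev c1 : {rmorphism {poly {poly A}} -> {poly A}} := map_poly (horner_eval c1).

(** The scalar is P(h, c2), which does not involve u; hence it becomes a constant at h = c1. *)
Lemma acts_subst2 (P : {mpoly A[2]}) : exists r : {poly {poly A}},
  acts iota l (subst2 P H1 H2) r /\ forall c1, ev c1 r = (ev2 P c1 c2)%:P.
Proof.
elim/mpoly_ring_ind: P => [a|i|f g [r [hr er]] [s [hs es]]|f g [r [hr er]] [s [hs es]]].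
- exists (iota a); rewrite /subst2 comp_mpolyC; split; first exact: actsC.
  by move=> c1; rewrite /ev2 mevalC /= map_polyC /= /horner_eval hornerC.
- rewrite /subst2 comp_mpolyXU -tnth_nth; case: i => [[|[|//]] hi].
    exists 'X%:P; split; first exact: acts_H1.
    by move=> c1; rewrite /ev2 mevalXU /= map_polyC /= /horner_eval hornerX.
  exists (iota c2); split; first exact: acts_H2.
  by move=> c1; rewrite /ev2 mevalXU /= map_polyC /= /horner_eval hornerC.
- exists (r + s); rewrite /subst2 rmorphD; split; first exact: actsD.
  by move=> c1; rewrite rmorphD er es /ev2 mevalD rmorphD.
exists (r * s); rewrite /subst2 rmorphM; split; first exact: actsM.
by move=> c1; rewrite rmorphM er es /ev2 mevalM rmorphM.
Qed.

Let at_h1 : {rmorphism {poly A} -> {mpoly A[3]}} := horner_alg H1.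

Let at_h1_x3 : {rmorphism {poly {poly A}} -> {mpoly A[3]}} :=
  horner_morph (fun r : {poly A} => mulrC (x3 ^+ 2) (at_h1 r)).

Let at_h1_x3_iota c : at_h1_x3 (iota c) = c%:MP.
Proof. by rewrite /at_h1_x3 /= horner_morphC /at_h1 /= horner_algC alg_mpolyC. Qed.

Let at_h1_x3_h : at_h1_x3 'X%:P = H1.
Proof. by rewrite /at_h1_x3 /= horner_morphC /at_h1 /= horner_algX. Qed.

Let at_h1_x3_u : at_h1_x3 'X = x3 ^+ 2.
Proof. by rewrite /at_h1_x3 /= horner_morphX. Qed.

Let at_x3 : {rmorphism {poly A} -> {mpoly A[3]}} := horner_alg (x3 ^+ 2).

Lemma x1_sqr : (a1 - a2)%:MP * x1 ^+ 2 = H1 - a2%:MP * H2 - (a3 - a2)%:MP * x3 ^+ 2.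
Proof. by rewrite /Defs.H1 /Defs.H2 -!mul_mpolyC !rmorphB; ring. Qed.

Lemma x2_sqr : (a1 - a2)%:MP * x2 ^+ 2 = a1%:MP * H2 + (a3 - a1)%:MP * x3 ^+ 2 - H1.
Proof. by rewrite /Defs.H1 /Defs.H2 -!mul_mpolyC !rmorphB; ring. Qed.

Let hbP (X Y : {mpoly A[3]}) : (a1 - a2)%:MP * X = Y -> X = b%:MP * Y.
Proof. by move=> <-; rewrite mulrA -mpolyCM hb mul1r. Qed.

Section Sphere.
Variable Y : formal_completion p (eqs_S c2) q.

Let psi : {rmorphism {poly {poly A}} -> Defs.coord Y} := coord_map Y \o at_h1_x3.

Lemma coord_S_H2 : coord_map Y H2 = coord_map Y c2%:MP.
Proof.
apply/eqP; rewrite -subr_eq0 -rmorphB; apply/eqP.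
exact: (coord_map_eq Y 0).
Qed.

Let psi_iota c : psi (iota c) = coord_map Y c%:MP.
Proof. by rewrite /psi /= at_h1_x3_iota. Qed.

Let psi_l i : psi (l i) = coord_map Y 'X_i ^+ 2.
Proof.
rewrite -rmorphXn; apply/eqP; rewrite -subr_eq0 -[psi _]/(coord_map Y (at_h1_x3 (l i))).
rewrite -rmorphB /= -[_ - _]/(at_h1_x3 (l i) - 'X_i ^+ 2); apply/eqP.
have hX j : val i = val j -> 'X_i = 'X_j :> {mpoly A[3]} by move/val_inj ->.
(* In [squares] the constant c2 replaces H2, so the two sides differ by c (H2 - c2), where c is the
   opposite of the coefficient of H2 in the formula for x_i^2; x3^2 needs no correction. *)
have [e|e] : (exists c : A, at_h1_x3 (l i) - 'X_i ^+ 2 = c%:MP * (H2 - c2%:MP)) \/ 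
   at_h1_x3 (l i) - 'X_i ^+ 2 = 0.
- rewrite /l /squares; case: i hX => [[|[|[|//]]] hi] /= hX.
  + left; exists (b * a2); rewrite (hX i1) // (hbP x1_sqr).
    rewrite !(rmorphM at_h1_x3, rmorphB at_h1_x3) !at_h1_x3_iota at_h1_x3_h at_h1_x3_u.
    by rewrite !mpolyCM; ring.
  + left; exists (- (b * a1)); rewrite (hX i2) // (hbP x2_sqr).
    rewrite !(rmorphM at_h1_x3, rmorphN at_h1_x3, rmorphD at_h1_x3).
    rewrite !at_h1_x3_iota at_h1_x3_h at_h1_x3_u.
    by rewrite mpolyCN !mpolyCM; ring.
  + by right; rewrite (hX i3) // -[horner_morph _ _]/(at_h1_x3 'X) at_h1_x3_u subrr.
- by case: e => c ->; rewrite rmorphM rmorphB coord_S_H2 subrr mulr0.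
by rewrite e rmorph0.
Qed.

Let S_acts (i : 'I_(size (eqs_S c2))) : acts iota l (eqs_S c2)`_i 0.
Proof.
case: i => [[|//] hi] /=.
by rewrite -(subrr (iota c2)); apply: actsD acts_H2 _; apply/actsN/actsC.
Qed.

Lemma poly2_torsionfree (r : {poly {poly A}}) : r *+ p = 0 -> r = 0.
Proof.
move=> rp; apply/polyP => i; apply/polyP => j; rewrite !coef0.
by apply: (mulrnp_inj A_dvr); rewrite -!coefMn rp !coef0.
Qed.

Lemma coord_S_torsionfree (x : Defs.coord Y) : x *+ p = 0 -> x = 0.
Proof.
exact: (parity_coord_torsionfree psi_iota psi_l S_acts poly2_torsionfree).
Qed.

Lemma coord_S_multiple f : (forall e, multiple p (parity_comp iota l e f)) ->
  multiple p (coord_map Y f).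
Proof. exact: (parity_comp_multiple psi_iota psi_l). Qed.

End Sphere.

Section Curve.
Variable c1 : A.
Variable Y : formal_completion p (eqs_E a1 a2 a3 c1 c2) q.

Let psi : {rmorphism {poly A} -> Defs.coord Y} := coord_map Y \o at_x3.
Let iotaE : {rmorphism A -> {poly A}} := ev c1 \o iota.
Let lE : 'I_3 -> {poly A} := ev c1 \o l.

Lemma coord_E_H1 : coord_map Y H1 = coord_map Y c1%:MP.
Proof.
apply/eqP; rewrite -subr_eq0 -rmorphB; apply/eqP.
exact: (coord_map_eq Y 0).
Qed.

Lemma coord_E_H2 : coord_map Y H2 = coord_map Y c2%:MP.
Proof.
apply/eqP; rewrite -subr_eq0 -rmorphB; apply/eqP.
exact: (coord_map_eq Y 1).
Qed.

Let ev_iota c : ev c1 (iota c) = c%:P.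
Proof. by rewrite /ev /= map_polyC /= /horner_eval hornerC. Qed.

Let ev_h : ev c1 'X%:P = c1%:P.
Proof. by rewrite /ev /= map_polyC /= /horner_eval hornerX. Qed.

Let ev_u : ev c1 'X = 'X.
Proof. by rewrite /ev /= map_polyX. Qed.

Let at_x3C c : at_x3 c%:P = c%:MP.
Proof. by rewrite /at_x3 /= horner_algC alg_mpolyC. Qed.

Let at_x3X : at_x3 'X = x3 ^+ 2.
Proof. by rewrite /at_x3 /= horner_algX. Qed.

Let psi_iota c : psi (iotaE c) = coord_map Y c%:MP.
Proof. by rewrite /psi /iotaE /= -[map_poly _ _]/(ev c1 (iota c)) ev_iota at_x3C. Qed.

Let lE1 : lE i1 = b%:P * (c1%:P - (a2 * c2)%:P - (a3 - a2)%:P * 'X).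
Proof.
rewrite /lE /= /l /squares /= -[map_poly _ _]/(ev c1 _).
by rewrite !(rmorphM (ev c1), rmorphB (ev c1)) !ev_iota ev_h ev_u.
Qed.

Let lE2 : lE i2 = b%:P * ((a1 * c2)%:P + (a3 - a1)%:P * 'X - c1%:P).
Proof.
rewrite /lE /= /l /squares /= -[map_poly _ _]/(ev c1 _).
by rewrite !(rmorphM (ev c1), rmorphN (ev c1), rmorphD (ev c1)) !ev_iota ev_h ev_u.
Qed.

Let lE3 : lE i3 = 'X.
Proof. exact: ev_u. Qed.

Let psi_l i : psi (lE i) = coord_map Y 'X_i ^+ 2.
Proof.
have hi j : val i = val j -> i = j by move/val_inj.
have cX j X : (a1 - a2)%:MP * 'X_j ^+ 2 = X -> psi (lE j) = coord_map Y (b%:MP * X) ->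
    psi (lE j) = coord_map Y 'X_j ^+ 2.
  by move=> /hbP e ->; rewrite -e rmorphXn.
case: i hi => [[|[|[|//]]] ?] hi.
- rewrite (hi i1) //; apply: (cX _ _ x1_sqr); rewrite lE1 /psi /=.
  rewrite !(rmorphM at_x3, rmorphB at_x3) !at_x3C at_x3X !mpolyCM.
  move: coord_E_H1 coord_E_H2; move: (H1) (H2) => h1 h2 e1 e2.
  by rewrite !(rmorphM, rmorphB) /= e1 e2.
- rewrite (hi i2) //; apply: (cX _ _ x2_sqr); rewrite lE2 /psi /=.
  rewrite !(rmorphM at_x3, rmorphN at_x3, rmorphD at_x3) !at_x3C at_x3X !mpolyCM.
  move: coord_E_H1 coord_E_H2; move: (H1) (H2) => h1 h2 e1 e2.
  by rewrite !(rmorphM, rmorphN, rmorphD) /= e1 e2.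
by rewrite (hi i3) // lE3 /psi /= at_x3X rmorphXn.
Qed.

Let E_acts (i : 'I_(size (eqs_E a1 a2 a3 c1 c2))) :
  acts iotaE lE (eqs_E a1 a2 a3 c1 c2)`_i 0.
Proof.
case: i => [[|[|//]] hi] /=.
- rewrite -(subrr c1%:P) -{1}ev_h -(ev_iota c1).
  by apply: actsD; [exact: acts_rmorph acts_H1 | apply/actsN/actsC].
rewrite -(subrr (ev c1 (iota c2))).
by apply: actsD; [exact: acts_rmorph acts_H2 | apply/actsN/actsC].
Qed.

Lemma coord_E_torsionfree (x : Defs.coord Y) : x *+ p = 0 -> x = 0.
Proof.
apply: (parity_coord_torsionfree psi_iota psi_l E_acts) => r rp.
apply/polyP => i; rewrite coef0; apply: (mulrnp_inj A_dvr).
by rewrite -coefMn rp coef0.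
Qed.

Let lead_lE1 : lead_coef (lE i1) \is a GRing.unit.
Proof.
have -> : lE i1 = (b * (a2 - a3))%:P * 'X + (b * (c1 - a2 * c2))%:P.
  by rewrite lE1 !rmorphM !rmorphB /= rmorphM; ring.
have u : b * (a2 - a3) \is a GRing.unit by rewrite unitrM unitrV a12_unit a23_unit.
rewrite mul_polyC lead_coefDl ?lead_coefZ ?lead_coefX ?mulr1 //.
rewrite size_scale ?size_polyX ?(leq_ltn_trans (size_polyC_leq1 _)) //.
by apply: contraTneq u => ->; rewrite unitr0.
Qed.

Let lead_lE2 : lead_coef (lE i2) \is a GRing.unit.
Proof.
have -> : lE i2 = (b * (a3 - a1))%:P * 'X + (b * (a1 * c2 - c1))%:P.
  by rewrite lE2 !rmorphM !rmorphB /= rmorphM; ring.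
have u : b * (a3 - a1) \is a GRing.unit by rewrite unitrM unitrV a12_unit a31_unit.
rewrite mul_polyC lead_coefDl ?lead_coefZ ?lead_coefX ?mulr1 //.
rewrite size_scale ?size_polyX ?(leq_ltn_trans (size_polyC_leq1 _)) //.
by apply: contraTneq u => ->; rewrite unitr0.
Qed.

(** The difficulty is the localization at q, since x1 x2 does not act by a scalar. Multiplying by a
    power of x1 x2 turns q into x1 x2 q = x1^2 x2^2 N A_{p-1}, which acts by a polynomial in u. Its
    leading coefficient is a unit: x1^2 and x2^2 are linear in u with unit leading coefficients, and
    N A_{p-1} is a unit constant. It can therefore be cancelled modulo p. *)
Lemma coord_E_multiple f e :
  ev2 (Npol a1 a2 a3) c1 c2 * ev2 (hasse p a1 a2 a3) c1 c2 \is a GRing.unit ->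
  multiple p (coord_map Y f) -> multiple p (ev c1 (parity_comp iota l e f)).
Proof.
move=> uNA [x hx]; rewrite parity_comp_rmorph -/iotaE -/lE.
case: (coord_fraction x) => f' [k hf'].
have /coord_map_eq0 [j hj] : coord_map Y (q ^+ k * f - f' *+ p) = 0.
  by rewrite rmorphB rmorphMn rmorphM rmorphXn hx -hf' mulrC mulrnAl subrr.
have [r [hr er]] := acts_subst2 (Npol a1 a2 a3).
have [s [hs es]] := acts_subst2 (hasse p a1 a2 a3).
have hM : acts iotaE lE ((x1 * x2) ^+ (j + k) * q ^+ (j + k))
   ((lE i1 * lE i2 * ((ev2 (Npol a1 a2 a3) c1 c2)%:P * (ev2 (hasse p a1 a2 a3) c1
     c2)%:P)) ^+ (j + k)).
  rewrite -exprMn; apply: actsX.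
  have -> : x1 * x2 * q = x1 ^+ 2 * x2 ^+ 2 * (subst2 (Npol a1 a2 a3) H1 H2 * subst2
    (hasse p a1 a2 a3) H1 H2).
    by rewrite /Qpol; ring.
  apply: actsM; first by apply: actsM; apply: acts_sqr.
  by rewrite -er -es; apply: actsM; apply: acts_rmorph.
have := parity_comp_ideal E_acts e ((x1 * x2) ^+ (j + k)) hj.
have -> : (x1 * x2) ^+ (j + k) * (q ^+ j * (q ^+ k * f - f' *+ p)) =
   (x1 * x2) ^+ (j + k) * q ^+ (j + k) * f - ((x1 * x2) ^+ (j + k) * q ^+ j * f') *+ p.
  by rewrite exprD (exprD q); ring.
rewrite (parity_compD iotaE lE) (morphDN (parity_compD iotaE lE e)).
rewrite (morphDMn (parity_compD iotaE lE e)) hM => /eqP; rewrite subr_eq0 => /eqP h.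
apply: (@multiple_mul_lead_unit p A); last by exists (parity_comp iotaE lE e ((x1 * x2)
  ^+ (j + k) * q ^+ j * f')); exact: h.
rewrite lead_coef_exp unitrX // !lead_coefM !unitrM lead_lE1 lead_lE2 /=.
by rewrite !lead_coefC -unitrM.
Qed.

End Curve.

(** * Density of the curves in the sphere modulo p *)

Section Density.
Variables (deltaA : A -> A).
Hypothesis k_infinite : infinite_residue_field p A.
Hypothesis lifts : forall a : A, exists c, cong p c a /\ deltaA c = 0.

Lemma incongruent_constants d : exists s : seq A,
  [/\ size s = d, pairwise (fun c c' => c' - c \is a GRing.unit) s &
      forall c, c \in s -> deltaA c = 0].
Proof.
elim: d => [|d [s [sz ps ds]]]; first by exists [::].
have [a ha] := k_infinite s; have [c [ca dc]] := lifts a.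
exists (c :: s); split=> /=; first by rewrite sz.
  rewrite ps andbT; apply/allP => c' hc'; apply: contraT => /(nonunit_multiple A_dvr) h.
  by case: (ha c' hc'); apply: cong_trans (cong_sym ca) (cong_sym h).
by move=> c'; rewrite inE => /orP [/eqP ->|/ds].
Qed.

Variable Y : formal_completion p (eqs_S c2) q.
Variable E : forall c1, formal_completion p (eqs_E a1 a2 a3 c1 c2) q.

(* After multiplication by N(H1,H2) A_{p-1}(H1,H2), which is invertible on the
   sphere, the components of f vanish modulo p at every constant h = c1. *)
Lemma multiple_of_fibres f :
  (forall c1, deltaA c1 = 0 ->
     ev2 (Npol a1 a2 a3) c1 c2 * ev2 (hasse p a1 a2 a3) c1 c2 \is a GRing.unit ->
     multiple p (coord_map (E c1) f)) ->
  multiple p (coord_map Y f).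
Proof.
move=> hf; pose v := subst2 (Npol a1 a2 a3) H1 H2 * subst2 (hasse p a1 a2 a3) H1 H2.
have [r [hr er]] := acts_subst2 (Npol a1 a2 a3).
have [s [hs es]] := acts_subst2 (hasse p a1 a2 a3).
have : multiple p (coord_map Y (v * f)).
  apply: coord_S_multiple => e.
  have -> : parity_comp iota l e (v * f) = r * s * parity_comp iota l e f.
    exact: (actsM hr hs).
  (* [P], the coefficient of u^j, is a polynomial in h; its size tells how many incongruent
     constants to take. *)
  apply: multiple_poly => j; set P := _`_j.
  have [t [szt pt dt]] := incongruent_constants (size P).
  apply: (multiple_many_roots _ pt) => [|c /dt dc]; first by rewrite szt.
  have -> : P.[c] = (ev c (r * s * parity_comp iota l e f))`_j by rewrite /ev coef_map.
  apply: multiple_coef; rewrite !rmorphM er es -rmorphM.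
  (* Where N A_{p-1} is not a unit, it is divisible by p and the factor r s already vanishes modulo
     p, so no constant has to be discarded. *)
  have [u|] := boolP (ev2 (Npol a1 a2 a3) c c2 * ev2 (hasse p a1 a2 a3) c c2 \is a
    GRing.unit).
    by apply: multipleMl; apply: (coord_E_multiple (Y := E c)) => //; apply: hf.
  move/(nonunit_multiple A_dvr) => h; apply: multipleMr.
  exact: (multiple_rmorph (polyC : {rmorphism A -> {poly A}})).
case: (coord_unit Y) => w.
have qE : q = v * (x1 * x2) by rewrite /v /Qpol; ring.
rewrite (congr1 (coord_map Y) qE) rmorphM -mulrA => hw.
by rewrite rmorphM; apply: multiple_cancel hw.
Qed.

End Density.

End EulerRings.

(** * Frobenius on the curves and on the spheres *)

(** The computation on a curve modulo p^2, with m = p: h and h' are the Hasse invariant and its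
    inverse, P and k are phi(W x3) and (W x3)^p, s is x3^(p-1) W x3, d is the contraction of dy with
    W, and wf, wg are W f, W g. The terms with two factors m die. *)
Lemma fibre_algebra (R : comPzRingType) m (h h' g d y wg wf f s P k b t : R) :
  (forall r : R, r *+ m *+ m = 0) -> P = k + t *+ m ->
  (P * (h' + b *+ m)) *+ m = (s + d) *+ m ->
  g * d + y * wg = wf -> y * g = f -> h * h' = 1 ->
  (h * (g ^+ 2 * s + g * wf - f * wg) - g ^+ 2 * k) *+ m = 0.
Proof.
move=> kill -> e <- <- hh.
transitivity (h * g ^+ 2 * ((s + d) *+ m) - g ^+ 2 * k *+ m); first by ring.
rewrite -e.
transitivity ((h * h') * g ^+ 2 * k *+ m - g ^+ 2 * k *+ m
  + (h * g ^+ 2 * (k * b + t * h' + t * b *+ m)) *+ m *+ m); first by ring.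
by rewrite hh mul1r subrr add0r kill.
Qed.

Section EulerField.
Variables (p : nat) (A : idomainType) (a1 a2 a3 : A).
Hypotheses (A_dvr : dvr_with_uniformizer p A) (p_odd : odd p).
Hypothesis a_unit : (a1 - a2) * (a2 - a3) * (a3 - a1) \is a GRing.unit.
Local Notation q := (Qpol p a1 a2 a3).
Local Notation H1 := (H1 a1 a2 a3).
Local Notation H2 := (H2 A).
Local Notation x1 := (x1 A).
Local Notation x2 := (x2 A).
Local Notation x3 := (x3 A).

(* The Hamiltonian vector field of H1 on the spheres, up to a factor -2; on E_c
   it is dual to omega_c. *)
Definition euler_field (i : 'I_3) : {mpoly A[3]} :=
  match val i with
  | 0 => (a2 - a3) *: (x2 * x3)
  | 1 => (a3 - a1) *: (x3 * x1)
  | _ => (a1 - a2) *: (x1 * x2)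
  end.

Let W := vector_field euler_field.

Let Wx3 : W x3 = euler_field (@Ordinal 3 2 isT).
Proof. exact: vector_fieldX. Qed.

Lemma vector_field_H1 w :
  vector_field w H1 = (a1%:MP * x1 * w (@Ordinal 3 0 isT)
    + a2%:MP * x2 * w (@Ordinal 3 1 isT)
    + a3%:MP * x3 * w (@Ordinal 3 2 isT)) *+ 2.
Proof.
rewrite /Defs.H1 -!mul_mpolyC !vector_fieldD !vector_fieldM !vector_fieldC.
by rewrite !vector_fieldX; ring.
Qed.

Lemma vector_field_H2 w :
  vector_field w H2 = (x1 * w (@Ordinal 3 0 isT) + x2 * w (@Ordinal 3 1 isT)
    + x3 * w (@Ordinal 3 2 isT)) *+ 2.
Proof.
by rewrite /Defs.H2 !vector_fieldD !vector_fieldM !vector_fieldX; ring.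
Qed.

Lemma euler_field_eqs c1 c2 (i : 'I_(size (eqs_E a1 a2 a3 c1 c2))) :
  W (eqs_E a1 a2 a3 c1 c2)`_i = 0.
Proof.
rewrite /W; case: i => [[|[|//]] hi] /=; rewrite vector_fieldB vector_fieldC subr0.
  by rewrite vector_field_H1 /euler_field /= -!mul_mpolyC !mpolyCB; ring.
by rewrite vector_field_H2 /euler_field /= -!mul_mpolyC !mpolyCB; ring.
Qed.

Section OnScheme.
Variables (gs : seq {mpoly A[3]}) (Y : formal_completion p gs q) (O : forms Y).
Local Notation dx f := (diff O (fn Y f)).

Lemma fn_x1_unit : exists v, fn Y x1 * v = 1.
Proof.
case: (fn_unit Y) => v.
have qE : q = x1 * (x2 * subst2 (Npol a1 a2 a3) H1 H2 * subst2 (hasse p a1 a2 a3) H1 H2).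
  by rewrite /Qpol !mulrA.
by rewrite (congr1 (fn Y) qE) rmorphM -mulrA => e; eexists; exact: e.
Qed.

Lemma fn_euler3_unit : exists v, fn Y (euler_field (@Ordinal 3 2 isT)) * v = 1.
Proof.
case: (fn_unit Y) => v.
pose r := subst2 (Npol a1 a2 a3) H1 H2 * subst2 (hasse p a1 a2 a3) H1 H2.
have qE : q = euler_field (@Ordinal 3 2 isT) * ((a1 - a2)^-1%:MP * r).
  rewrite /euler_field /= -mul_mpolyC.
  transitivity ((a1 - a2)%:MP * (a1 - a2)^-1%:MP * (x1 * x2 * r)); last by ring.
  by rewrite -mpolyCM divrr ?(a12_unit a_unit) // mul1r /Qpol /r !mulrA.
by rewrite (congr1 (fn Y) qE) rmorphM -mulrA => e; eexists; exact: e.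
Qed.

Lemma half_torsionfree (M : lmodType (fun_ring Y)) (u : M) : u *+ 2 = 0 -> u = 0.
Proof.
move=> /(congr1 (fun z => cst Y (2%:R^-1) *: z)); rewrite scaler0 => <-.
rewrite -scalerMnr scalerMnl /cst -rmorphMn -mpolyCMn -(mulr_natr 2%:R^-1) mulVr
  ?rmorph1 ?scale1r //.
exact: two_unit A_dvr p_odd.
Qed.

Lemma diff_H1 : dx H1 =
  (fn Y (a1 *: x1) *: dx x1 + fn Y (a2 *: x2) *: dx x2 + fn Y (a3 *: x3) *: dx x3) *+ 2.
Proof.
have e (a : A) x : dx (a *: x ^+ 2) = (fn Y (a *: x) *: dx x) *+ 2.
  have dP := diff_derivation O.
  have -> : fn Y (a *: x ^+ 2) = cst Y a * fn Y x ^+ 2.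
    by rewrite -mul_mpolyC rmorphM rmorphXn.
  rewrite (derivationM dP) (derivation_alg dP) scaler0 addr0 (derivationX dP) expr1.
  by rewrite -mul_mpolyC rmorphM -scalerMnr scalerA.
by rewrite /Defs.H1 !rmorphD !(derivationD (diff_derivation O)) /= !e !mulrnDl.
Qed.

Lemma diff_H2 : dx H2 =
  (fn Y x1 *: dx x1 + fn Y x2 *: dx x2 + fn Y x3 *: dx x3) *+ 2.
Proof.
rewrite /Defs.H2 !rmorphD !(derivationD (diff_derivation O)) !rmorphXn /=.
by rewrite !(derivationX (diff_derivation O)) /= !expr1 !mulrnDl.
Qed.

Lemma diff_frobenius (y : fun_ring Y) :
  diff O (fn Y x3 ^+ p + y *+ p) = (fn Y x3 ^+ p.-1 *: dx x3 + diff O y) *+ p.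
Proof.
rewrite (derivationD (diff_derivation O)) (derivationMn (diff_derivation O)).
by rewrite (derivationX (diff_derivation O)) mulrnDl.
Qed.

End OnScheme.

(** * The congruence on a curve *)

Section Fibre.
Variables (c1 c2 : A) (Y : formal_completion p (eqs_E a1 a2 a3 c1 c2) q).
Variable O : forms Y.
Local Notation dx f := (diff O (fn Y f)).

Lemma fn_E_H1 : fn Y H1 = cst Y c1.
Proof. by rewrite /cst /fn coord_E_H1. Qed.

Lemma fn_E_H2 : fn Y H2 = cst Y c2.
Proof. by rewrite /cst /fn coord_E_H2. Qed.

(** The hypothesis on the curves speaks of all forms with the defining relations, so one has to be
    exhibited: dx3 / W(x3). Eliminating between dH1 = 0 and dH2 = 0, linear relations among the x_i
    dx_i, gives the other two expressions. *)
Lemma omega_exists : exists w : Omega1 O, is_omega w.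
Proof.
have [u hu] := fn_euler3_unit Y; rewrite /euler_field /= in hu.
pose t x := fn Y x *: dx x.
have r2 : t x1 + t x2 + t x3 = 0.
  apply: half_torsionfree; rewrite -diff_H2 fn_E_H2.
  exact: (derivation_alg (diff_derivation O)).
have r1 : cst Y a1 *: t x1 + cst Y a2 *: t x2 + cst Y a3 *: t x3 = 0.
  have eZ (a : A) x : cst Y a *: t x = fn Y (a *: x) *: dx x.
    by rewrite /t scalerA -mul_mpolyC rmorphM.
  apply: half_torsionfree; rewrite !eZ -diff_H1 fn_E_H1.
  exact: (derivation_alg (diff_derivation O)).
have e1 : cst Y (a1 - a2) *: t x1 = cst Y (a2 - a3) *: t x3.
  have := r1; have -> : t x2 = - t x1 - t x3.
    by apply/eqP; rewrite -opprD -addr_eq0 addrA [t x2 + _]addrC r2.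
  rewrite scalerBr scalerN /cst !mpolyCB !rmorphB !scalerBl => h.
  apply/eqP; rewrite -subr_eq0 -h; apply/eqP; rewrite opprB !addrA.
  by rewrite [RHS]addrAC.
have e2 : cst Y (a1 - a2) *: t x2 = cst Y (a3 - a1) *: t x3.
  have := r1; have -> : t x1 = - t x2 - t x3.
    by apply/eqP; rewrite -opprD -addr_eq0 addrA r2.
  rewrite scalerBr scalerN /cst !mpolyCB !rmorphB !scalerBl => h.
  apply/eqP; rewrite -subr_eq0 -oppr_eq0 -h; apply/eqP; rewrite !opprB.
  by rewrite /= [LHS]addrC addrACA [LHS]addrC addrA.
have key x (c : A) y : fn Y y * fn Y x = fn Y x1 * fn Y x2 ->
     cst Y (a1 - a2) *: t x = cst Y c *: t x3 ->
    fn Y (c *: (y * x3)) *: (u *: dx x3) = dx x.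
  move=> yx e; rewrite -[RHS](scale1r _) -hu -!mul_mpolyC !rmorphM.
  transitivity ((u * fn Y y) *: (cst Y (a1 - a2) *: t x)).
    by rewrite e /t !scalerA /cst; congr (_ *: _); ring.
  by rewrite /t !scalerA -yx /cst; congr (_ *: _); ring.
exists (u *: dx x3); split.
- by apply: key e1; rewrite mulrC.
- by rewrite [x3 * x1]mulrC; apply: key e2.
by rewrite scalerA hu scale1r.
Qed.

Definition hasse_H1 : {mpoly A[3]} := subst2 (hasse p a1 a2 a3) H1 c2%:MP.

Lemma fn_E_hasse : fn Y hasse_H1 = cst Y (ev2 (hasse p a1 a2 a3) c1 c2).
Proof.
rewrite /hasse_H1; elim/mpoly_ring_ind: (hasse p a1 a2 a3) => [a|i|f g hf hg|f g hf hg].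
- by rewrite /subst2 comp_mpolyC /ev2 mevalC.
- rewrite /subst2 comp_mpolyXU -tnth_nth /ev2 mevalXU; case: i => [[|[|//]] hi] //=.
  exact: fn_E_H1.
- by rewrite /subst2 rmorphD /ev2 mevalD /cst mpolyCD !rmorphD; congr (_ + _).
by rewrite /subst2 rmorphM /ev2 mevalM /cst mpolyCM !rmorphM; congr (_ * _).
Qed.

(* With y = delta x3 written as f/g, this is g^2 times
   A_{p-1}(H1,c2) (x3^(p-1) W x3 + W y) - (W x3)^p. *)
Definition obstruction (f g : {mpoly A[3]}) : {mpoly A[3]} :=
  hasse_H1 * (g ^+ 2 * (x3 ^+ p.-1 * W x3) + g * W f - f * W g)
  - g ^+ 2 * W x3 ^+ p.

(* Dividing phi^* omega_c by p only makes sense modulo p-torsion; applying the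
   functional dual to omega_c modulo p^2 leaves an equation multiplied by p in
   the coordinate ring modulo p^2, which gives one modulo p. *)
Lemma fibre_obstruction (phi : {rmorphism fun_ring Y -> fun_ring Y})
    (G : Omega1 O -> Omega1 O) (y z : fun_ring Y) (f g : {mpoly A[3]}) :
  divided_pullback1 phi G ->
  (forall w, is_omega w -> cong p (G w) (cst Y (ev2 (hasse p a1 a2 a3) c1 c2)^-1 *: w)) ->
  ev2 (hasse p a1 a2 a3) c1 c2 \is a GRing.unit ->
  phi (fn Y x3) = fn Y x3 ^+ p + y *+ p ->
  cong p (phi (fn Y (W x3))) (fn Y (W x3) ^+ p) ->
  y * fn Y g = fn Y f + z *+ p ^ 2 ->
  multiple p (coord_map Y (obstruction f g)).
Proof.
move=> [_ [F [[[FD FZ] Fd] GF]]] hG uh phix3 [t ht] hy.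
have [w hw] := omega_exists; have [b hb] := hG w hw.
have w3 : fn Y (W x3) *: w = dx x3 by rewrite Wx3; case: hw.
have [l lf] := red_functional O 2 (@euler_field_eqs c1 c2).
pose L (v : Omega1 O) : red Y 2 := l (Omega_proj 2 v).
have LD : {morph L : u v / u + v} by move=> u v; rewrite /L Omega_projD linearD.
have LMn u k : L (u *+ k) = L u *+ k by exact: morphDMn.
have LZ a u : L (a *: u) = proj Y 2 a * L u.
  by rewrite /L Omega_projZ linearZ.
have Lfn r : L (dx r) = red_fn Y 2 (W r) by rewrite /L diffP proj_fn lf.
have LdM r s : L (diff O (r * s)) = proj Y 2 r * L (diff O s) + proj Y 2 s * L (diff O r).
  by rewrite (derivationM (diff_derivation O)) LD !LZ.
have kill (r : red Y 2) : r *+ p *+ p = 0 by rewrite -mulrnA; exact: red_mulrn.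
have Lw : L w = 1.
  have [v hv] := fn_euler3_unit Y.
  have := congr1 (proj Y 2) hv; rewrite rmorphM rmorph1 /= proj_fn => hv2.
  have := congr1 L w3; rewrite LZ Lfn proj_fn Wx3 => /(congr1 (fun r => proj Y 2 v * r)).
  by rewrite mulrA [proj Y 2 v * _]mulrC hv2 mul1r.
(* The pull-back of dx3 = W(x3) omega is computed twice: as d phi(x3), and as phi(W x3) times the
   pull-back of omega. *)
have e1 : (phi (fn Y (W x3)) *: (cst Y (ev2 (hasse p a1 a2 a3) c1 c2)^-1 *: w + b *+ p)) *+ p
    = (fn Y x3 ^+ p.-1 *: dx x3 + diff O y) *+ p.
  rewrite -diff_frobenius -phix3 -Fd -w3 FZ -GF scalerMnr; congr (_ *: (_ *+ _)).
  by rewrite -hb addrC subrK.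
have := congr1 L e1; rewrite !LMn LZ !LD !LZ LMn Lw mulr1 Lfn => {}e1.
(* Differentiate y g = f + p^2 z; the last term is zero modulo p^2. *)
have ey : red_fn Y 2 g * L (diff O y) + proj Y 2 y * red_fn Y 2 (W g) = red_fn Y 2 (W f).
  have := congr1 (fun r => L (diff O r)) hy; rewrite LdM.
  rewrite (derivationD (diff_derivation O)) (derivationMn (diff_derivation O)).
  by rewrite LD LMn red_mulrn addr0 !Lfn proj_fn addrC; exact.
have ey0 : proj Y 2 y * red_fn Y 2 g = red_fn Y 2 f.
  by rewrite -!proj_fn -rmorphM hy rmorphD rmorphMn red_mulrn addr0.
apply: red2_torsion => [x|]; first exact: coord_E_torsionfree.
rewrite /obstruction !(rmorphB, rmorphM, rmorphD, rmorphXn) /=.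
rewrite rmorphXn /= proj_fn in e1; rewrite -!expr2.
apply: (fibre_algebra kill _ e1 ey ey0).
- by have /(congr1 (proj Y 2)) := ht; rewrite rmorphB rmorphMn rmorphXn /= proj_fn =>
  /eqP; rewrite subr_eq addrC => /eqP ->.
by rewrite -proj_fn fn_E_hasse -rmorphM /cst -rmorphM -mpolyCM divrr // !rmorph1.
Qed.

End Fibre.

(** On the sphere p is cancelled twice, in the torsion-free ring of functions of the completion; the
    contractions at finite levels are therefore assembled into one with values there. *)
Lemma limit_functional (gs : seq {mpoly A[3]}) (Y : formal_completion p gs q) (O : forms Y)
    (l : forall n, {linear Omega_red O n -> (red Y n)^o}) :
  (forall n u, trans Y n (l n.+1 u) = l n (Omega_trans u)) ->
  exists L : Omega1 O -> (fun_ring Y)^o,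
    linear L /\ forall n u, proj Y n (L u) = l n (Omega_proj n u).
Proof.
move=> hl; case: (projP Y) => _ hlim; case: (Omega_projP O) => ht _.
have h u : exists x, forall n, proj Y n x = l n (Omega_proj n u).
  case: (hlim (fun n => l n (Omega_proj n u))) => [n|x [hx _]]; last by exists x.
  by rewrite hl ht.
pose L u := proj1_sig (constructive_indefinite_description _ (h u)).
have hL u n : proj Y n (L u) = l n (Omega_proj n u).
  by rewrite /L; case: constructive_indefinite_description.
exists L; split=> [a u v|//]; apply: proj_inj => n.
by rewrite rmorphD rmorphM !hL Omega_projD Omega_projZ linearD linearZ.
Qed.

(** * The area form and the congruence on the sphere *)

Section Sphere.
Variables (c2 : A) (Y : formal_completion p (eqs_S c2) q) (O : forms Y).
Local Notation dx f := (diff O (fn Y f)).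

Lemma fn_S_H2 : fn Y H2 = cst Y c2.
Proof. by rewrite /cst /fn coord_S_H2. Qed.

(* The rotations of the sphere about the x3 and x2 axes; divided by x1, they
   form the frame dual to dx2, dx3. *)
Definition rotation3 (i : 'I_3) : {mpoly A[3]} :=
  match val i with 0 => - x2 | 1 => x1 | _ => 0 end.

Definition rotation2 (i : 'I_3) : {mpoly A[3]} :=
  match val i with 0 => - x3 | 1 => 0 | _ => x1 end.

Lemma rotation3_eqs (i : 'I_(size (eqs_S c2))) : vector_field rotation3 (eqs_S c2)`_i = 0.
Proof.
case: i => [[|//] hi] /=; rewrite vector_fieldB vector_fieldC subr0 vector_field_H2.
by rewrite /rotation3 /=; ring.
Qed.

Lemma rotation2_eqs (i : 'I_(size (eqs_S c2))) : vector_field rotation2 (eqs_S c2)`_i = 0.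
Proof.
case: i => [[|//] hi] /=; rewrite vector_fieldB vector_fieldC subr0 vector_field_H2.
by rewrite /rotation2 /=; ring.
Qed.

(** Both sides are linear in u, which reduces the claim to u = ds. The difference is then a
    derivation in s, so the coordinates suffice: it vanishes at x1 because x1 dx1 + x2 dx2 + x3 dx3
    = 0, and at x2, x3 by the values of the two rotations. *)
Lemma red_frame n (l3 l2 : {linear Omega_red O n -> (red Y n)^o}) :
  (forall f, l3 (d_red O (red_fn Y n f)) = red_fn Y n (vector_field rotation3 f)) ->
  (forall f, l2 (d_red O (red_fn Y n f)) = red_fn Y n (vector_field rotation2 f)) ->
  forall u, red_fn Y n x1 *: u =
    (l3 u : red Y n) *: d_red O (red_fn Y n x2) + (l2 u : red Y n) *: d_red O (red_fn Y n x3).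
Proof.
move=> h3 h2; pose d f := d_red O (red_fn Y n f); have dP := d_red_derivation O n.
have r2 : red_fn Y n x1 *: d x1 + red_fn Y n x2 *: d x2 + red_fn Y n x3 *: d x3 = 0.
  have r2 : fn Y x1 *: dx x1 + fn Y x2 *: dx x2 + fn Y x3 *: dx x3 = 0.
    apply: half_torsionfree; rewrite -diff_H2 fn_S_H2.
    exact: (derivation_alg (diff_derivation O)).
  have := congr1 (Omega_proj n) r2; rewrite (morphD0 (@Omega_projD _ _ _ _ _ O n)).
  by rewrite !Omega_projD !Omega_projZ !diffP !proj_fn.
apply: (kaehler_ext (d_redP O n)) => [a u v|a u v|s].
- by rewrite scalerDr !scalerA mulrC.
- by rewrite (linearP l3) (linearP l2) /= !scalerDl scalerDr !scalerA addrACA.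
apply/eqP; rewrite -subr_eq0; apply/eqP.
pose D s := red_fn Y n x1 *: d_red O s -
  ((l3 (d_red O s) : red Y n) *: d x2 + (l2 (d_red O s) : red Y n) *: d x3).
have DP : derivation (red_cst Y n) D.
  split=> [x y|x y|a]; rewrite /D.
  - rewrite (derivationD dP) scalerDr !(linearD l3, linearD l2) !scalerDl.
    by rewrite [in RHS]addrACA -opprD; congr (_ - _); rewrite addrACA.
  - rewrite (derivationM dP) !(linearD l3, linearD l2) !(linearZZ l3,
    linearZZ l2) /= !scalerBr !scalerDr !scalerDl !scalerA.
    rewrite ![red_fn Y n x1 * _]mulrC.
    by rewrite [in RHS]addrACA -opprD; congr (_ - _); rewrite addrACA.
  by rewrite (derivation_alg dP) (linear0 l3) (linear0 l2) !scale0r scaler0 addr0 subrr.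
rewrite -/(D s); apply: (red_derivation_eq0 DP) => i; rewrite /D h3 h2 !vector_fieldX.
case: i => [[|[|[|//]]] hi]; rewrite /rotation3 /rotation2 /=.
- have -> : 'X_(Ordinal hi) = x1 by congr 'X_ _; apply: val_inj.
  by rewrite !rmorphN !scaleNr -opprD opprK addrA; exact: r2.
- have -> : 'X_(Ordinal hi) = x2 by congr 'X_ _; apply: val_inj.
  by rewrite rmorph0 scale0r addr0 subrr.
have -> : 'X_(Ordinal hi) = x3 by congr 'X_ _; apply: val_inj.
by rewrite rmorph0 scale0r add0r subrr.
Qed.

Lemma sphere_frame : exists l3 l2 : Omega1 O -> (fun_ring Y)^o,
  [/\ linear l3, linear l2,
      l3 (dx x2) = fn Y x1 /\ l3 (dx x3) = 0,
      l2 (dx x2) = 0 /\ l2 (dx x3) = fn Y x1 &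
      forall u, fn Y x1 *: u =
        (l3 u : fun_ring Y) *: dx x2 + (l2 u : fun_ring Y) *: dx x3].
Proof.
have choose w : (forall i : 'I_(size (eqs_S c2)), vector_field w (eqs_S c2)`_i = 0) ->
    exists k : forall n, {linear Omega_red O n -> (red Y n)^o},
      forall n f, k n (d_red O (red_fn Y n f)) = red_fn Y n (vector_field w f).
  move=> hw; pose k n := constructive_indefinite_description _ (red_functional O n hw).
  by exists (fun n => proj1_sig (k n)) => n; exact: (proj2_sig (k n)).
have [k3 h3] := choose _ rotation3_eqs; have [k2 h2] := choose _ rotation2_eqs.
have frame n := red_frame (h3 n) (h2 n).
have [v hv] := fn_x1_unit Y.
have hvn n : proj Y n v * red_fn Y n x1 = 1 by rewrite -proj_fn -rmorphM mulrC hv rmorph1.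
have r32 : vector_field rotation3 x2 = x1 by rewrite vector_fieldX.
have r33 : vector_field rotation3 x3 = 0 by rewrite vector_fieldX.
have r22 : vector_field rotation2 x2 = 0 by rewrite vector_fieldX.
have r23 : vector_field rotation2 x3 = x1 by rewrite vector_fieldX.
have trans_fn n f : trans Y n (red_fn Y n.+1 f) = red_fn Y n f by exact: transP.
(* Compatibility with the transition maps is read off from the frame: the identity at level n+1 is
   moved to level n and contracted there, and the unit x1 is cancelled. *)
have transl n u : red_fn Y n x1 *: Omega_trans u =
    trans Y n (k3 n.+1 u) *: d_red O (red_fn Y n x2)
    + trans Y n (k2 n.+1 u) *: d_red O (red_fn Y n x3).
  have [tD tZ] := Omega_trans_semilinear O n.
  have := congr1 (@Omega_trans _ _ _ _ _ O n) (frame n.+1 u).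
  by rewrite tD !tZ !Omega_trans_d !trans_fn.
have [n u|l3 [lin3 hl3]] := @limit_functional _ Y O k3.
  have := congr1 (fun z => proj Y n v * (k3 n z : red Y n)) (transl n u).
  rewrite linearD !linearZZ !h3 r32 r33 rmorph0 /GRing.scale /= mulr0 addr0.
  by rewrite mulrA hvn mul1r mulrCA hvn mulr1.
have [n u|l2 [lin2 hl2]] := @limit_functional _ Y O k2.
  have := congr1 (fun z => proj Y n v * (k2 n z : red Y n)) (transl n u).
  rewrite linearD !linearZZ !h2 r22 r23 rmorph0 /GRing.scale /= mulr0 add0r.
  by rewrite mulrA hvn mul1r mulrCA hvn mulr1.
exists l3, l2; split=> //.
- by split; apply: proj_inj => n; rewrite hl3 diffP proj_fn h3 ?r32 ?r33 ?rmorph0 ?proj_fn.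
- by split; apply: proj_inj => n; rewrite hl2 diffP proj_fn h2 ?r22 ?r23 ?rmorph0 ?proj_fn.
move=> u; apply: Omega_proj_inj => n.
rewrite Omega_projD !Omega_projZ hl3 hl2 !diffP !proj_fn; exact: frame.
Qed.

(** Two-forms are thus free of rank one on eta, with coordinate m. Expanding x1 u and x1 w in the
    frame gives x1^2 (u /\ w) = b(u, w) dx2 /\ dx3 = b(u, w) x1 eta, whence m = b / x1 on u /\ w. *)
Lemma sphere_area (eta : Omega2 O) : is_eta eta ->
  exists m : Omega2 O -> (fun_ring Y)^o,
    [/\ linear m, m eta = 1 & forall w, w = (m w : fun_ring Y) *: eta].
Proof.
case=> e23 _ _; have [l3 [l2 [lin3 lin2 [l32 l33] [l22 l23] frame]]] := sphere_frame.
have [wP univ] := wedgeP O; have [v hv] := fn_x1_unit Y.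
pose b u u' : (fun_ring Y)^o := l3 u * l2 u' - l2 u * l3 u'.
have bP : alternating_bilinear b.
  by split=> [a u u' w|a u w w'|u]; rewrite /b ?lin3 ?lin2 /GRing.scale /=; ring.
have [M [hM _]] := univ _ b bP.
pose m w : (fun_ring Y)^o := v * (M w : fun_ring Y).
have lin_m : linear m.
  by move=> a u u'; rewrite /m linearP /GRing.scale /=; ring.
have m1 : m eta = 1.
  have := congr1 (fun z => v * (M z : fun_ring Y)) e23.
  rewrite hM /b l32 l33 l22 l23 linearZZ /GRing.scale /= => e.
  rewrite /m; transitivity (v * (v * (fn Y x1 * (M eta : fun_ring Y)))).
    by rewrite !mulrA -[v * v * _]mulrA [v * fn Y _]mulrC hv mulr1.
  rewrite e; transitivity ((fn Y x1 * v) * (fn Y x1 * v)); first by ring.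
  by rewrite hv mulr1.
exists m; split=> //.
apply: (exterior_square_ext (wedgeP O)) => [a u w //|a u w|u w].
  by rewrite lin_m scalerDl [in RHS]scalerA.
have -> : m (wedge u w) = v * b u w by rewrite -hM.
rewrite -[LHS]scale1r -[1](mulr1 1) -hv.
transitivity ((v * v) *: wedge (fn Y x1 *: u) (fn Y x1 *: w)).
  by rewrite (wedgeZl wP) (wedgeZr wP) !scalerA; congr (_ *: _); ring.
rewrite !frame !(wedgeDl wP, wedgeDr wP, wedgeZl wP, wedgeZr wP) !(wedgevv wP) !scaler0.
rewrite add0r addr0 (wedgeC wP (dx x3) (dx x2)) -e23 -scaleNr !scalerA.
rewrite -scalerDl !scalerA /b; congr (_ *: _).
transitivity ((fn Y x1 * v) * (v * ((l3 u : fun_ring Y) * l2 w - (l2 u : fun_ring Y) *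
  l3 w))); first by ring.
by rewrite hv mul1r.
Qed.

Lemma fn_S_hasse_unit : exists v, fn Y (hasse_H1 c2) * v = 1.
Proof.
have e : fn Y (hasse_H1 c2) = fn Y (subst2 (hasse p a1 a2 a3) H1 H2).
  rewrite /hasse_H1; elim/mpoly_ring_ind: (hasse p a1 a2 a3) => [a|i|f g hf hg|f g hf hg].
  - by rewrite /subst2 !comp_mpolyC.
  - rewrite /subst2 !comp_mpolyXU -!tnth_nth; case: i => [[|[|//]] hi] //=.
    by rewrite fn_S_H2.
  - by rewrite /subst2 !rmorphD; congr (_ + _).
  by rewrite /subst2 !rmorphM; congr (_ * _).
case: (fn_unit Y) => v.
have qE : q = subst2 (hasse p a1 a2 a3) H1 H2 * (x1 * x2 * subst2 (Npol a1 a2 a3) H1 H2).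
  by rewrite /Qpol mulrC.
by rewrite (congr1 (fn Y) qE) rmorphM -mulrA e => h; eexists; exact: h.
Qed.

Lemma euler_contraction (eta : Omega2 O) i : is_eta eta ->
  wedge (dx H1) (dx 'X_i) = (- (fn Y (euler_field i) *+ 2)) *: eta.
Proof.
case=> e1 e2 e3; have [wP _] := wedgeP O.
have wA := wedgeDl wP; have wM := wedgeMnl wP; have wZ := wedgeZl wP.
have wZ' (a : A) x (u v : Omega1 O) : wedge (fn Y (a *: x) *: u) v = cst Y a *: (fn Y x
  *: wedge u v).
  by rewrite (wedgeZl wP) -mul_mpolyC rmorphM scalerA.
rewrite (diff_H1 O) wM !wA !wZ' -mulNrn -scalerMnl; congr (_ *+ 2).
have hX j : val i = val j -> i = j by move/val_inj.
case: i hX => [[|[|[|//]]] hi] hX.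
- rewrite (hX (@Ordinal 3 0 isT)) // (wedgevv wP) -e2 (wedgeC wP (dx x2)) -e3.
  rewrite !scaler0 add0r -!scaleNr !scalerA -scalerDl; congr (_ *: _).
  rewrite /euler_field /= -mul_mpolyC mpolyCB !(rmorphM, rmorphB) /cst /=; ring.
- rewrite (hX (@Ordinal 3 1 isT)) // (wedgevv wP) -e3 (wedgeC wP (dx x3)) -e1.
  rewrite !scaler0 addr0 -!scaleNr !scalerA -scalerDl; congr (_ *: _).
  rewrite /euler_field /= -mul_mpolyC mpolyCB !(rmorphM, rmorphB) /cst /=; ring.
rewrite (hX (@Ordinal 3 2 isT)) // (wedgevv wP) -e1 (wedgeC wP (dx x1)) -e2.
rewrite !scaler0 addr0 -!scaleNr !scalerA -scalerDl; congr (_ *: _).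
rewrite /euler_field /= -mul_mpolyC mpolyCB !(rmorphM, rmorphB) /cst /=; ring.
Qed.

(** With m = p: c and l are the coefficients of [G eta] and of [lambda *: eta], H is H1^(p-1), h the
    Hasse invariant, k and w are (W x3)^p and W x3, x is x3^(p-1), and d, v are the coefficients of
    dH1 /\ dy and dH1 /\ dz. The factor of c - l in the conclusion is a unit in the application. *)
Lemma sphere_algebra (R : comPzRingType) m (h l c H k t w x d g y wg wf f s v z : R) :
  - ((k + t *+ m) *+ 2) * c = H * (x * - (w *+ 2) + d) ->
  g * d + y * - (wg *+ 2) = - (wf *+ 2) + v *+ m *+ m ->
  y * g = f + z *+ m *+ m ->
  h * (g ^+ 2 * (x * w) + g * wf - f * wg) - g ^+ 2 * k = s *+ m ->
  l * h = H ->
  multiple m (k *+ 2 * g ^+ 2 * h * (c - l)).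
Proof.
move=> e1 e2 e3 e4 e5.
(* The claim is a linear combination of the five hypotheses; the witness collects the terms carrying
   a factor m. *)
exists (- (t *+ 2) * c * g ^+ 2 * h + H * s *+ 2 - H * h * (z *+ 2 * wg + g * v) *+ m).
apply/eqP; rewrite -subr_eq0; apply/eqP.
transitivity
  (- (g ^+ 2 * h) * (- ((k + t *+ m) *+ 2) * c - H * (x * - (w *+ 2) + d))
   - H * h * g * (g * d + y * - (wg *+ 2) - (- (wf *+ 2) + v *+ m *+ m))
   - H * h * wg *+ 2 * (y * g - (f + z *+ m *+ m))
   + H *+ 2 * (h * (g ^+ 2 * (x * w) + g * wf - f * wg) - g ^+ 2 * k - s *+ m)
   - k *+ 2 * g ^+ 2 * (l * h - H)); first by ring.
by rewrite e1 e2 e3 e4 e5 !subrr !mulr0 !subr0 !addr0.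
Qed.

Lemma sphere_congruence (phi : {rmorphism fun_ring Y -> fun_ring Y})
    (G : Omega2 O -> Omega2 O) (eta : Omega2 O) (lambda y z : fun_ring Y)
    (f g : {mpoly A[3]}) :
  is_eta eta -> divided_pullback2 phi G ->
  phi (fn Y H1) = fn Y H1 ^+ p -> phi (fn Y x3) = fn Y x3 ^+ p + y *+ p ->
  cong p (phi (fn Y (W x3))) (fn Y (W x3) ^+ p) ->
  y * fn Y g = fn Y f + z *+ p ^ 2 -> (exists v, fn Y g * v = 1) ->
  multiple p (coord_map Y (obstruction c2 f g)) ->
  lambda * fn Y (hasse_H1 c2) = fn Y H1 ^+ p.-1 ->
  cong p (G eta) (lambda *: eta).
Proof.
move=> he [_ [F [F2 [[[[FD FZ] Fd] [F2D F2Z] F2w] GF]]]] phiH1 phix3 [t ht] hy [v hv].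
move=> [s hs] hl; have [wP _] := wedgeP O.
have [m [lin_m m1 mE]] := sphere_area he.
have mD : {morph m : u w / u + w} := linear_fun_add lin_m.
have mMn u k : m (u *+ k) = m u *+ k by exact: morphDMn.
have mZ a u : m (a *: u) = a * (m u : fun_ring Y) by exact: linear_fun_scale.
pose V u : fun_ring Y := m (wedge (dx H1) u).
have VD : {morph V : u w / u + w} by move=> u w; rewrite /V (wedgeDr wP) mD.
have VMn u k : V (u *+ k) = V u *+ k by exact: morphDMn.
have VZ a u : V (a *: u) = a * V u by rewrite /V (wedgeZr wP) mZ.
(* As f |-> V(df) is a derivation, its values on the coordinates identify it with -2 W. *)
have VdP : derivation (cst Y) (V \o diff O : _ -> (fun_ring Y)^o).
  have dP := diff_derivation O; split=> [a b|a b|a] /=.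
  - by rewrite (derivationD dP) VD.
  - by rewrite (derivationM dP) VD !VZ.
  by rewrite (derivation_alg dP) (morphD0 VD).
have Vfn r : V (dx r) = - (fn Y (W r) *+ 2).
  have := derivation_mpoly (rho := fn Y) VdP r; rewrite /= => -> => [|a].
    rewrite /W /vector_field rmorph_sum -sumrMnl -sumrN; apply: eq_bigr => i _.
    by rewrite /V (euler_contraction _ he) mZ m1 mulr1 rmorphM /GRing.scale /=; ring.
  exact: (derivation_alg VdP).
pose c : fun_ring Y := m (G eta).
have tf := fun_ring_torsionfree (@coord_S_torsionfree _ _ _ _ _ A_dvr a_unit _ Y).
have e1 : - ((fn Y (W x3) ^+ p + t *+ p) *+ 2) * c =
    fn Y H1 ^+ p.-1 * (fn Y x3 ^+ p.-1 * - (fn Y (W x3) *+ 2) + V (diff O y)).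
  (* One factor p, with H1^(p-1), comes from the exact equality phi(H1) = H1^p, the other from d
     phi(x3). Both are cancelled only after the contraction with eta. *)
  have e : wedge (F (dx H1)) (F (dx x3)) =
      (fn Y H1 ^+ p.-1 *: wedge (dx H1) (fn Y x3 ^+ p.-1 *: dx x3 + diff O y)) *+ p *+ p.
    rewrite !Fd phiH1 phix3 diff_frobenius (derivationX (diff_derivation O)).
    by rewrite (wedgeMnl wP) (wedgeMnr wP) (wedgeZl wP).
  have := congr1 m e; rewrite -F2w (mE (wedge (dx H1) (dx x3))) -/(V _) F2Z -GF.
  rewrite mZ !mMn mZ -/(V _) VD VZ !Vfn -/c => {}e.
  apply/eqP; rewrite -subr_eq0; apply/eqP/tf/tf; rewrite !mulrnBl -e.
  have -> : fn Y (W x3) ^+ p + t *+ p = phi (fn Y (W x3)) by rewrite -ht addrC subrK.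
  rewrite rmorphN rmorphMn /=.
  have -> : c *+ p ^ 2 = c *+ p *+ p by rewrite -mulrnA.
  ring.
have e2 : fn Y g * V (diff O y) + y * - (fn Y (W g) *+ 2)
    = - (fn Y (W f) *+ 2) + V (diff O z) *+ p *+ p.
  have := congr1 (fun r => V (diff O r)) hy; have dP := diff_derivation O.
  rewrite (derivationM dP) (derivationD dP) (derivationMn dP) !VD !VZ VMn !Vfn.
  by rewrite addrC -mulrnA; exact.
have e3 : y * fn Y g = fn Y f + z *+ p *+ p by rewrite hy -mulrnA.
have e4 : fn Y (hasse_H1 c2) * (fn Y g ^+ 2 * (fn Y x3 ^+ p.-1 * fn Y (W x3))
    + fn Y g * fn Y (W f) - fn Y f * fn Y (W g)) - fn Y g ^+ 2 * fn Y (W x3) ^+ p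
    = completion_map Y s *+ p.
  by rewrite -rmorphMn -hs -/(fn Y _) /obstruction !(rmorphB, rmorphM, rmorphD,
    rmorphXn) -!expr2.
have := sphere_algebra e1 e2 e3 e4 hl.
have [u hu] := fn_S_hasse_unit; have [r hr] := fn_euler3_unit Y.
have [i2 hi2] : exists i2 : fun_ring Y, i2 *+ 2 = 1.
  exists (cst Y 2%:R^-1); rewrite /cst -rmorphMn -mpolyCMn -(mulr_natr 2%:R^-1).
  by rewrite mulVr ?rmorph1 // (two_unit A_dvr p_odd).
have inv : fn Y (W x3) ^+ p *+ 2 * fn Y g ^+ 2 * fn Y (hasse_H1 c2) * (r ^+ p * i2 * v
  ^+ 2 * u) = 1.
  transitivity ((fn Y (W x3) * r) ^+ p * (i2 *+ 2) * (fn Y g * v) ^+ 2 * (fn Y (hasse_H1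
    c2) * u)).
    by rewrite !exprMn; ring.
  by rewrite Wx3 hr hv hu hi2 !expr1n !mulr1.
case/(multiple_cancel inv) => b hb.
exists (b *: eta); rewrite (mE (G eta)) -/c scalerMnl -hb scalerBl; exact.
Qed.

End Sphere.

End EulerField.
Theorem theorem4p6
    (p : nat) (p_prime : prime p) (p_odd : odd p)
    (A : idomainType)
    (A_dvr : dvr_with_uniformizer p A)
    (A_complete : padically_complete p A)
    (k_perfect : perfect_residue_field p A)
    (k_infinite : infinite_residue_field p A)
    (phiA : {rmorphism A -> A}) (deltaA : A -> A)
    (phiA_lift : attached p deltaA phiA)
    (a1 a2 a3 : A)
    (a_unit : (a1 - a2) * (a2 - a3) * (a3 - a1) \is a GRing.unit)
    (X : formal_completion p (eqs_X A) (Qpol p a1 a2 a3))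
    (E : forall c1 c2 : A,
       formal_completion p (eqs_E a1 a2 a3 c1 c2) (Qpol p a1 a2 a3))
    (OE : forall c1 c2 : A, forms (E c1 c2))
    (resE : forall c1 c2 : A, {rmorphism fun_ring X -> fun_ring (E c1 c2)})
    (resE_restriction : forall c1 c2 : A, restriction (resE c1 c2))
    (deltaX : fun_ring X -> fun_ring X)
    (phiX : {rmorphism fun_ring X -> fun_ring X})
    (phiX_attached : attached p deltaX phiX)
    (phiX_phiA : forall a : A, phiX (cst X a) = cst X (phiA a))
    (deltaX_H1 : deltaX (fn X (H1 a1 a2 a3)) = 0)
    (deltaX_H2 : deltaX (fn X (H2 A)) = 0)
    (deltaX_E : fibre_congruence deltaA phiX OE resE)
    (c2 : A) (c2_unit : c2 \is a GRing.unit) (c2_const : deltaA c2 = 0)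
    (S : formal_completion p (eqs_S c2) (Qpol p a1 a2 a3))
    (OS : forms S)
    (resS : {rmorphism fun_ring X -> fun_ring S})
    (resS_restriction : restriction resS)
    (phiS : {rmorphism fun_ring S -> fun_ring S})
    (phiS_induced : induces resS phiX phiS)
    (G : Omega2 OS -> Omega2 OS) (G_pullback : divided_pullback2 phiS G)
    (eta : Omega2 OS) (eta_def : is_eta eta)
    (lambda : fun_ring S)
    (lambda_def :
       lambda * fn S (subst2 (hasse p a1 a2 a3) (H1 a1 a2 a3) c2%:MP) =
       fn S (H1 a1 a2 a3) ^+ p.-1) :
  cong p (G eta) (lambda *: eta).
Proof.
(* The fraction representing delta x3 modulo p^2 is fixed on X, before any restriction. *)
have [f [k hf]] := red_fraction (proj X 2 (deltaX (fn X (x3 A)))).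
pose g := Qpol p a1 a2 a3 ^+ k.
have [z hz] : multiple (p ^ 2) (deltaX (fn X (x3 A)) * fn X g - fn X f).
  by apply: proj_eq0; rewrite rmorphB rmorphM !proj_fn /g rmorphXn /= hf subrr.
have lift gs (Y : formal_completion p gs (Qpol p a1 a2 a3))
    (res : {rmorphism fun_ring X -> fun_ring Y}) (phi : {rmorphism fun_ring Y ->
      fun_ring Y}) :
    restriction res -> induces res phiX phi ->
    forall h, phi (fn Y h) = fn Y h ^+ p + res (deltaX (fn X h)) *+ p.
  move=> hres hphi h; rewrite -!hres hphi phiX_attached.
  by rewrite rmorphD rmorphXn rmorphMn.
have hcong gs (Y : formal_completion p gs (Qpol p a1 a2 a3))
    (res : {rmorphism fun_ring X -> fun_ring Y}) (phi : {rmorphism fun_ring Y -> fun_ring Y})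
    (hres : restriction res) (hphi : induces res phiX phi) h :
    cong p (phi (fn Y h)) (fn Y h ^+ p).
  rewrite (lift _ _ _ _ hres hphi); exists (res (deltaX (fn X h))).
  by rewrite addrAC subrr add0r.
have hyf gs (Y : formal_completion p gs (Qpol p a1 a2 a3))
    (res : {rmorphism fun_ring X -> fun_ring Y}) (hres : restriction res) :
    res (deltaX (fn X (x3 A))) * fn Y g = fn Y f + res z *+ p ^ 2.
  by rewrite -!hres -rmorphM -rmorphMn -hz -rmorphD addrC subrK.
apply: (sphere_congruence A_dvr p_odd a_unit eta_def G_pullback
  (y := resS (deltaX (fn X (x3 A)))) (z := resS z) (f := f) (g := g)) => //.
- by rewrite (lift _ _ _ _ resS_restriction phiS_induced) deltaX_H1 rmorph0 mul0rn addr0.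
- exact: lift.
- exact: hcong.
- exact: hyf.
- have [v hv] := fn_unit S; exists (v ^+ k).
  by rewrite /g rmorphXn -exprMn hv expr1n.
have lifts := teichmuller_lift A_dvr A_complete k_perfect phiA_lift.
(* What remains is the obstruction on the curves H1 = c1 inside the given sphere, with c1 a
   Teichmueller lift. *)
apply: (multiple_of_fibres A_dvr a_unit k_infinite lifts S (E := fun c1 => E c1 c2)).
move=> c1 dc1 uNA; have [phi [G1 [hphi hG1 hw]]] := deltaX_E c1 c2 dc1 c2_const uNA.
have hresE := resE_restriction c1 c2.
apply: (fibre_obstruction A_dvr p_odd a_unit hG1 hw _ (lift _ _ _ _ hresE hphi _)
  (hcong _ _ _ _ hresE hphi _) (hyf _ _ _ hresE)).
by move: uNA; rewrite unitrM => /andP [].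
Qed.
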